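(* Let $G=H+J$ be a finite group of triangular type, let $\alpha=(e,\theta,\omega^* )\in\mathfrak A$, and let $g=h+x\in G$ with $h\in H$, $x\in J$ and $hx=xh=x$. Then the value of the supercharacter $\chi_\alpha$ on $g$ is $$\chi_\alpha(g)=\frac{|H_e|\cdot\dot\theta(h)}{n(\Omega^* )}\sum_{\mu\in\Omega^*}\varepsilon^{\mu(x)},$$ where $n(\Omega^* )$ is the number of right $N_f$-orbits (orbits of $\mu\mapsto\mu a$, $a\in N_f$) in $\Omega^*$. (Here $f$ and $\Omega^*$ are attached to $h$ and $\omega^*$ as in the context; if $h\notin H(e)$, then $\dot\theta(h)=0$ and the right-hand side is understood to be $0$.)
   Context: Setting. Let $k=\mathbb F_q$ be a finite field, $H$ a finite abelian group with $\mathrm{char}\,k\nmid |H|$, and $J$ a finite-dimensional nilpotent associative $k$-algebra with commuting $k$-linear left and right actions $(h,x)\mapsto hx$, $(h,x)\mapsto xh$ of $H$ on $J$ such that $h(xy)=(hx)y$, $(xy)h=x(yh)$, $x(hy)=(xh)y$ for all $h\in H$, $x,y\in J$. Then $A=kH\oplus J$ is an associative unital algebra with multiplication extending $(h_1+x_1)(h_2+x_2)=h_1h_2+h_1x_2+x_1h_2+x_1x_2$. The set $G=H+J=\{h+x: h\in H,x\in J\}\subset A$ is a finite group under this multiplication, called a finite group of triangular type. For $\lambda\in J^*=\mathrm{Hom}_k(J,k)$, $c\in A$ write $(c\lambda)(x)=\lambda(xc)$, $(\lambda c)(x)=\lambda(cx)$. Idempotents. For an idempotent $e\in A$ ($e=0$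 allowed) put $e'=1-e$, $A_e=eAe$, $J_e=eJe$; $J_e^*$ is identified with the set of $\lambda\in J^*$ vanishing on $eJe'$, $e'Je$, $e'Je'$. For an idempotent $e\in kH$ put $H_e=\{he:h\in H\}$ (a group with identity $e$), $N_e=e+J_e$, $G_e=H_e+J_e$, and let $\widetilde{G_e}$ be the group of triples $\tau=(t,a,b)$, $t\in H_e$, $a,b\in N_e$, with product $(t_1,a_1,b_1)(t_2,a_2,b_2)=(t_1t_2,\ t_2^{-1}a_1t_2a_2,\ t_2^{-1}b_1t_2b_2)$, acting on $J_e$ by $\rho(\tau)(x)=taxb^{-1}t^{-1}$ (inverses in $G_e$) and on $J_e^*$ by $(\rho^*(\tau)\lambda)(x)=\lambda(\rho(\tau^{-1})(x))$. Put $H(e)=\{h\in H: he=e\}$. An element of $J_e^*$ is regular in $J_e^*$ if it does not lie in $J_f^*$ for any idempotent $f\in A_e$, $f\neq e$; an orbit is regular if its elements are regular. Supercharacters. $\mathfrak A$ is the set of triples $\alpha=(e,\theta,\omega^* )$ with $e$ an idempotent in $kH$, $\theta:H(e)\to\mathbb C^*$ a linear character, and $\omega^*$ a regular $\widetilde{G_e}$-orbit in $J_e^*$. Fix a nontrivial character $t\mapsto\varepsilon^t$ of the additive group of $\mathbb F_q$ with values in $\mathbb C^*$. For $\lambda\in\omega^*$ let $J_{\lambda,\mathrm{right}}=\{x\in J:\lambda x=0\}$, $G_\lambda=\{h+x: h\in H(e),\ x\in J_{\lambda,\mathrm{right}}\}$ (a subgroup of $G$), $\xi_{\theta,\lambda}(h+x)=\theta(h)\varepsilon^{\lambda(x)}$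 (a linear character of $G_\lambda$), and $\chi_{\theta,\lambda}=\mathrm{ind}(\xi_{\theta,\lambda},G_\lambda,G)$, the induced character. Put $\chi_\alpha=\chi_{\theta,\lambda}$ for any $\lambda\in\omega^*$ (independent of the choice of $\lambda$). Data attached to $h$. Two elements of $kH$ are associated if they differ by a factor in $(kH)^*$; every element of $kH$ is associated with a unique idempotent of $kH$. For $h\in H$, $f'$ denotes the idempotent of $kH$ associated with $h-1$, and $f=1-f'$; the condition $hx=xh=x$ is equivalent to $x\in J_f$. If $h\in H(e)$, then $ef=e$, so $J_e^*\subset J_f^*$ and $\omega^*\subset J_f^*$; $\Omega^*$ denotes the unique $\widetilde{G_f}$-orbit in $J_f^*$ whose intersection with $J_e^*$ is $\omega^*$. $\dot\theta:H\to\mathbb C$ equals $\theta$ on $H(e)$ and $0$ outside $H(e)$. *)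

(* Defs.v *)
From HB Require Import structures.
From mathcomp Require Import all_boot all_order all_algebra all_fingroup.
From mathcomp Require Import all_solvable all_field all_character.

Set Implicit Arguments.
Unset Strict Implicit.
Unset Printing Implicit Defensive.

Import GRing.Theory Num.Theory.
Local Open Scope ring_scope.

(* Over a finite field, a finite-dimensional k-space is the same thing as a   *)
(* finite one, whence J : finLmodType k.  J carries an associative product    *)
(* without unit; nilpotency says that all products of n + 1 elements vanish.  *)
Record triangularDatum (k : finFieldType) (hT : finGroupType) :=
  TriangularDatum {
    tJ :> finLmodType k;
    mulJ : tJ -> tJ -> tJ;
    lactJ : hT -> tJ -> tJ;
    ractJ : tJ -> hT -> tJ;
    hT_abelian : abelian [set: hT];
    char_ndvd : forall p, p \in [pchar k] -> ~~ (p %| #|hT|)%N;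
    mulJ_linl : forall y, linear (mulJ^~ y);
    mulJ_linr : forall x, linear (mulJ x);
    mulJA : forall x y z, mulJ x (mulJ y z) = mulJ (mulJ x y) z;
    mulJ_nil : exists n, forall (x : tJ) (s : seq tJ),
      size s = n -> foldl mulJ x s = 0;
    lact_lin : forall h, linear (lactJ h);
    ract_lin : forall h, linear (ractJ^~ h);
    lact1 : forall x, lactJ 1%g x = x;
    ract1 : forall x, ractJ x 1%g = x;
    lactM : forall g h x, lactJ (g * h)%g x = lactJ g (lactJ h x);
    ractM : forall g h x, ractJ x (g * h)%g = ractJ (ractJ x g) h;
    lractC : forall g h x, ractJ (lactJ g x) h = lactJ g (ractJ x h);
    lact_mulJ : forall h x y, lactJ h (mulJ x y) = mulJ (lactJ h x) y;
    ract_mulJ : forall h x y, ractJ (mulJ x y) h = mulJ x (ractJ y h);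
    mulJ_lact : forall h x y, mulJ x (lactJ h y) = mulJ (ractJ x h) y
  }.

(* A = kH (+) J; an element of kH is its family of coefficients. *)
Definition triAlg (k : finFieldType) (hT : finGroupType)
  (T : triangularDatum k hT) : Type := ({ffun hT -> k} * tJ T)%type.

Section TriangularAlgebra.

Context {k : finFieldType} {hT : finGroupType} (T : triangularDatum k hT).

Local Notation J := (tJ T).
Local Notation A := (triAlg T).

HB.instance Definition _ := GRing.Zmodule.copy A ({ffun hT -> k} * J)%type.
HB.instance Definition _ := Finite.copy A ({ffun hT -> k} * J)%type.

Definition gdelta (h : hT) : {ffun hT -> k} := [ffun g => (g == h)%:R].
Definition gconv (a b : {ffun hT -> k}) : {ffun hT -> k} :=
  [ffun g => \sum_h a h * b (h^-1 * g)%g].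
Definition glact (a : {ffun hT -> k}) (x : J) : J := \sum_h a h *: lactJ h x.
Definition gract (x : J) (a : {ffun hT -> k}) : J := \sum_h a h *: ractJ x h.

Definition triMul (u v : A) : A :=
  (gconv u.1 v.1, glact u.1 v.2 + gract u.2 v.1 + mulJ u.2 v.2).
Definition triOne : A := (gdelta 1%g, 0).

Lemma linear_sumZ (V W : lmodType k) (f : V -> W) (I : finType)
    (c : I -> k) (x : I -> V) :
  linear f -> f (\sum_i c i *: x i) = \sum_i c i *: f (x i).
Proof.
move=> fl; have f0 : f 0 = 0.
  have := fl (-1) 0 0; rewrite scaler0 addr0 => ->.
  by rewrite scaleN1r addNr.
by apply: (big_rec2 (fun a b => f a = b)) => // i a b _ <-; rewrite fl.
Qed.

Lemma linear_add (V W : lmodType k) (f : V -> W) :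
  linear f -> {morph f : x y / x + y}.
Proof. by move=> fl x y; have := fl 1 x y; rewrite !scale1r. Qed.

Lemma linear_zero (V W : lmodType k) (f : V -> W) : linear f -> f 0 = 0.
Proof.
move=> fl; have := fl (-1) 0 0; rewrite scaler0 addr0 => ->.
by rewrite scaleN1r addNr.
Qed.

Lemma gconvA : associative gconv.
Proof.
move=> a b c; apply/ffunP=> g; rewrite !ffunE.
under eq_bigr do rewrite ffunE mulr_sumr.
under [RHS]eq_bigr do rewrite ffunE mulr_suml.
rewrite [RHS]exchange_big /=; apply: eq_bigr => h _.
rewrite [RHS](reindex_inj (mulgI h)) /=; apply: eq_bigr => l _.
by rewrite mulKg invMg !mulgA mulrA.
Qed.

Lemma gconv1l : left_id (gdelta 1%g) gconv.
Proof.
move=> a; apply/ffunP=> g; rewrite ffunE (bigD1 1%g) //= ffunE eqxx mul1r.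
by rewrite invg1 mul1g big1 ?addr0 // => h /negPf h1; rewrite ffunE h1 mul0r.
Qed.

Lemma gconv1r : right_id (gdelta 1%g) gconv.
Proof.
move=> a; apply/ffunP=> g; rewrite ffunE (bigD1 g) //= ffunE mulVg eqxx mulr1.
rewrite big1 ?addr0 // => h h1; rewrite ffunE -eq_mulVg1 (negPf h1).
by rewrite mulr0.
Qed.

Lemma gconvDl : left_distributive gconv +%R.
Proof.
move=> a b c; apply/ffunP=> g; rewrite !ffunE -big_split /=.
by apply: eq_bigr => h _; rewrite ffunE mulrDl.
Qed.

Lemma gconvDr : right_distributive gconv +%R.
Proof.
move=> a b c; apply/ffunP=> g; rewrite !ffunE -big_split /=.
by apply: eq_bigr => h _; rewrite ffunE mulrDr.
Qed.

Lemma gdeltaM g h : gconv (gdelta g) (gdelta h) = gdelta (g * h)%g.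
Proof.
apply/ffunP=> l; rewrite ffunE (bigD1 g) //= !ffunE eqxx mul1r.
rewrite big1 ?addr0 => [|i /negPf ig]; last by rewrite ffunE ig mul0r.
by rewrite (can2_eq (mulKVg g) (mulKg g)).
Qed.

Lemma gdelta_inj : injective gdelta.
Proof.
move=> g h /ffunP/(_ g); rewrite !ffunE eqxx; case: eqP => // _ /eqP.
by rewrite oner_eq0.
Qed.

Lemma glactD a : {morph glact a : x y / x + y}.
Proof.
move=> x y; rewrite -big_split; apply: eq_bigr => h _ /=.
by rewrite (linear_add (lact_lin h)) scalerDr.
Qed.

Lemma gractD a : {morph gract^~ a : x y / x + y}.
Proof.
move=> x y; rewrite -big_split; apply: eq_bigr => h _ /=.
by rewrite (linear_add (ract_lin h)) scalerDr.
Qed.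

Lemma glact0 a : glact a 0 = 0.
Proof.
by rewrite /glact big1 // => h _; rewrite (linear_zero (lact_lin h)) scaler0.
Qed.

Lemma gract0 a : gract 0 a = 0.
Proof.
by rewrite /gract big1 // => h _; rewrite (linear_zero (ract_lin h)) scaler0.
Qed.

Lemma glactDl x : {morph glact^~ x : a b / a + b}.
Proof.
move=> a b; rewrite -big_split; apply: eq_bigr => h _ /=.
by rewrite ffunE scalerDl.
Qed.

Lemma gractDl x : {morph gract x : a b / a + b}.
Proof.
move=> a b; rewrite -big_split; apply: eq_bigr => h _ /=.
by rewrite ffunE scalerDl.
Qed.

Lemma glact_delta h x : glact (gdelta h) x = lactJ h x.
Proof.
rewrite /glact (bigD1 h) //= ffunE eqxx scale1r big1 ?addr0 // => g /negPf gh.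
by rewrite ffunE gh scale0r.
Qed.

Lemma gract_delta h x : gract x (gdelta h) = ractJ x h.
Proof.
rewrite /gract (bigD1 h) //= ffunE eqxx scale1r big1 ?addr0 // => g /negPf gh.
by rewrite ffunE gh scale0r.
Qed.

Lemma glactM a b x : glact (gconv a b) x = glact a (glact b x).
Proof.
rewrite /glact; under eq_bigr do rewrite ffunE scaler_suml.
rewrite exchange_big /=; apply: eq_bigr => h _.
rewrite (linear_sumZ _ _ (lact_lin h)) scaler_sumr.
rewrite (reindex_inj (mulgI h)) /=; apply: eq_bigr => g _.
by rewrite mulKg lactM scalerA.
Qed.

Lemma gractM a b x : gract x (gconv a b) = gract (gract x a) b.
Proof.
rewrite /gract; under eq_bigr do rewrite ffunE scaler_suml.
under [RHS]eq_bigr => g _ do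
  rewrite (linear_sumZ _ _ (ract_lin g)) scaler_sumr.
rewrite exchange_big /= [RHS]exchange_big /=; apply: eq_bigr => h _.
rewrite (reindex_inj (mulgI h)) /=; apply: eq_bigr => g _.
by rewrite mulKg ractM scalerA mulrC.
Qed.

Lemma glractC a b x : gract (glact a x) b = glact a (gract x b).
Proof.
rewrite /gract /glact.
under eq_bigr => g _ do rewrite (linear_sumZ _ _ (ract_lin g)) scaler_sumr.
under [RHS]eq_bigr => g _ do
  rewrite (linear_sumZ _ _ (lact_lin g)) scaler_sumr.
rewrite exchange_big /=; apply: eq_bigr => g _; apply: eq_bigr => h _.
by rewrite !scalerA mulrC lractC.
Qed.

Lemma glact_mulJ a x y : mulJ (glact a x) y = glact a (mulJ x y).
Proof.
rewrite /glact (linear_sumZ _ _ (mulJ_linl y)).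
by apply: eq_bigr => h _; rewrite lact_mulJ.
Qed.

Lemma gract_mulJ a x y : mulJ x (gract y a) = gract (mulJ x y) a.
Proof.
rewrite /gract (linear_sumZ _ _ (mulJ_linr x)).
by apply: eq_bigr => h _; rewrite ract_mulJ.
Qed.

Lemma mulJ_glact a x y : mulJ x (glact a y) = mulJ (gract x a) y.
Proof.
rewrite /gract /glact (linear_sumZ _ _ (mulJ_linr x)).
rewrite (linear_sumZ _ _ (mulJ_linl y)).
by apply: eq_bigr => h _; rewrite mulJ_lact.
Qed.

Fact triMulA : associative triMul.
Proof.
move=> u v w; rewrite /triMul /= gconvA; congr (_, _).
rewrite !glactD !gractD !(linear_add (mulJ_linl _)) !(linear_add (mulJ_linr _)).
rewrite glactM gractM glractC glact_mulJ gract_mulJ mulJ_glact mulJA !addrA.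
congr (_ + _); rewrite -!addrA; congr (_ + (_ + _)); rewrite addrCA.
by congr (_ + _); rewrite addrA addrC.
Qed.

Fact triMul1l : left_id triOne triMul.
Proof.
case=> a x; rewrite /triMul /triOne /= gconv1l glact_delta lact1 gract0.
by rewrite (linear_zero (mulJ_linl x)) !addr0.
Qed.

Fact triMul1r : right_id triOne triMul.
Proof.
case=> a x; rewrite /triMul /triOne /= gconv1r gract_delta ract1 glact0.
by rewrite (linear_zero (mulJ_linr x)) add0r addr0.
Qed.

Lemma triAddE (u v : A) : u + v = (u.1 + v.1, u.2 + v.2) :> A.
Proof. by []. Qed.

Fact triMulDl : left_distributive triMul +%R.
Proof.
move=> u v w; rewrite triAddE /triMul /= gconvDl glactDl gractD.
rewrite (linear_add (mulJ_linl _)); congr (_, _).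
by rewrite [RHS]addrACA; congr (_ + _); rewrite addrACA.
Qed.

Fact triMulDr : right_distributive triMul +%R.
Proof.
move=> u v w; rewrite triAddE /triMul /= gconvDr glactD gractDl.
rewrite (linear_add (mulJ_linr _)); congr (_, _).
by rewrite [RHS]addrACA; congr (_ + _); rewrite addrACA.
Qed.

Fact triOne_neq0 : triOne != 0.
Proof.
apply/eqP => -[/ffunP/(_ 1%g)]; rewrite !ffunE eqxx => /eqP.
by rewrite oner_eq0.
Qed.

HB.instance Definition _ := GRing.Zmodule_isNzRing.Build A
  triMulA triMul1l triMul1r triMulDl triMulDr triOne_neq0.
HB.instance Definition _ := FinRing.isNzRing.Build A.

Definition inH (h : hT) : A := (gdelta h, 0).
Definition inJ (x : J) : A := (0, x).

Lemma triME (u v : A) : u * v = triMul u v. Proof. by []. Qed.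

Lemma inH1 : inH 1%g = 1. Proof. by []. Qed.

Lemma inHM g h : inH (g * h)%g = inH g * inH h.
Proof.
rewrite triME /triMul /= gdeltaM glact0 gract0 (linear_zero (mulJ_linl 0)).
by rewrite !addr0.
Qed.

Lemma inHJ h x : inH h * inJ x = inJ (lactJ h x).
Proof.
rewrite triME /triMul /= glact_delta gract0 (linear_zero (mulJ_linl x)) !addr0.
congr (_, _); apply/ffunP => g; rewrite !ffunE big1 // => l _.
by rewrite !ffunE mulr0.
Qed.

Lemma inJH h x : inJ x * inH h = inJ (ractJ x h).
Proof.
rewrite triME /triMul /= gract_delta glact0 (linear_zero (mulJ_linr x)) addr0.
rewrite add0r; congr (_, _); apply/ffunP => g; rewrite !ffunE big1 // => l _.
by rewrite !ffunE mul0r.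
Qed.

Lemma inJM x y : inJ x * inJ y = inJ (mulJ x y).
Proof.
rewrite triME /triMul /=; congr (_, _).
  by apply/ffunP => g; rewrite !ffunE big1 // => l _; rewrite !ffunE mul0r.
rewrite /glact /gract !big1 ?add0r // => h _; first by rewrite ffunE scale0r.
by rewrite ffunE scale0r.
Qed.

Lemma inJD x y : inJ (x + y) = inJ x + inJ y.
Proof. by rewrite triAddE /= addr0. Qed.

Lemma inHDJ h x : inH h + inJ x = (gdelta h, x).
Proof. by rewrite triAddE /= addr0 add0r. Qed.

Lemma inHJ_mul h1 h2 x1 x2 :
  (inH h1 + inJ x1) * (inH h2 + inJ x2) =
  inH (h1 * h2)%g + inJ (lactJ h1 x2 + ractJ x1 h2 + mulJ x1 x2).
Proof.
rewrite mulrDl !mulrDr inHJ inJH inJM inHM !inJD -!addrA; congr (_ + _).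
Qed.

Fact triUnit h x : inH h + inJ x \is a GRing.unit.
Proof.
have Hu : inH h \is a GRing.unit.
  apply/unitrP; exists (inH h^-1%g).
  by rewrite -!inHM mulVg mulgV.
have -> : inH h + inJ x = inH h * (1 + inJ (lactJ h^-1%g x)).
  by rewrite mulrDr mulr1 inHJ -lactM mulgV lact1.
rewrite unitrMr //; set y := lactJ _ _.
have [n Jn] := mulJ_nil T.
have yX m : inJ y ^+ m.+1 = inJ (foldl (@mulJ _ _ T) y (nseq m y)).
  elim: m => [|m IHm]; first by rewrite expr1.
  by rewrite exprSr IHm inJM -[m.+1]addn1 nseqD foldl_cat.
have y0 : inJ y ^+ n.+1 = 0 by rewrite yX Jn ?size_nseq.
pose z := - inJ y; have zX : z ^+ n.+1 = 0 by rewrite exprNn y0 mulr0.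
have -> : 1 + inJ y = 1 - z by rewrite opprK.
have cz : GRing.comm (1 - z) (\sum_(i < n.+1) z ^+ i).
  apply: commr_sum => i _; apply/commr_sym/commrB; first exact: commr1.
  exact/commr_sym/commrX.
have z1 : (1 - z) * (\sum_(i < n.+1) z ^+ i) = 1.
  by apply: oppr_inj; rewrite -mulNr opprB -subrX1 zX sub0r.
by apply/unitrP; exists (\sum_(i < n.+1) z ^+ i); rewrite -{1}cz z1.
Qed.

Definition Gelt (h : hT) (x : J) : {unit A} := FinRing.unit A (triUnit h x).

Lemma val_Gelt h x : val (Gelt h x) = (gdelta h, x).
Proof. exact: inHDJ. Qed.

(* G = H + J; triUnit shows that it consists of units of A. *)
Definition triG : {set {unit A}} := [set Gelt p.1 p.2 | p : hT * J].

Lemma mem_triG h x : Gelt h x \in triG.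
Proof. exact: (imset_f _ (x := (h, x))). Qed.

Lemma GeltM h1 h2 x1 x2 :
  (Gelt h1 x1 * Gelt h2 x2)%g =
  Gelt (h1 * h2)%g (lactJ h1 x2 + ractJ x1 h2 + mulJ x1 x2).
Proof. by apply: val_inj; rewrite FinRing.val_unitM /= inHJ_mul. Qed.

Lemma Gelt1 : Gelt 1%g 0 = 1%g.
Proof. by apply: val_inj; rewrite /= inHDJ. Qed.

Fact triG_group_set : group_set triG.
Proof.
apply/group_setP; split; first by rewrite -Gelt1 mem_triG.
move=> _ _ /imsetP[[h1 x1] _ ->] /imsetP[[h2 x2] _ ->].
by rewrite GeltM mem_triG.
Qed.
Canonical triG_group := Group triG_group_set.

Definition idem (e : A) : bool := e * e == e.
Definition kH : {set A} := [set c : A | c.2 == 0].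

(* J^*, as the set of all linear maps J -> k. *)
Definition Jdual : {set {ffun J -> k}} :=
  [set l : {ffun J -> k} |
    [forall a : k, forall x, forall y, l (a *: x + y) == a * l x + l y]].

(* Meant for c in the ideal J of A only. *)
Definition evJ (l : {ffun J -> k}) (c : A) : k := l c.2.

(* In the right action l c, the factor c multiplies the argument on the left. *)
Definition mulr_dual (l : {ffun J -> k}) (c : A) : {ffun J -> k} :=
  [ffun x => evJ l (c * inJ x)].

(* J_e^*, identified with a subset of J^*. *)
Definition Jdual_at (e : A) : {set {ffun J -> k}} :=
  [set l in Jdual | [forall x,
    [&& evJ l (e * inJ x * (1 - e)) == 0,
        evJ l ((1 - e) * inJ x * e) == 0 &
        evJ l ((1 - e) * inJ x * (1 - e)) == 0]]].

Definition Hat (e : A) : {set A} := [set inH h * e | h : hT].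
Definition Jat (e : A) : {set A} := [set e * inJ x * e | x : J].
Definition Nat (e : A) : {set A} := [set e + y | y in Jat e].
Definition Gat (e : A) : {set A} := [set t + y | t in Hat e, y in Jat e].

(* Inverse in the group G_e, whose identity is e rather than 1; not a unit   *)
(* inverse of A in general.                                                   *)
Definition inv_at (e c : A) : A :=
  odflt 0 [pick d in Gat e | (c * d == e) && (d * c == e)].

Definition Gtilde (e : A) : {set A * A * A} :=
  [set p | [&& p.1.1 \in Hat e, p.1.2 \in Nat e & p.2 \in Nat e]].
Definition tmul (e : A) (p q : A * A * A) : A * A * A :=
  let: (t1, a1, b1) := p in let: (t2, a2, b2) := q in
  (t1 * t2, inv_at e t2 * a1 * t2 * a2, inv_at e t2 * b1 * t2 * b2).
Definition tone (e : A) : A * A * A := (e, e, e).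
Definition tinv (e : A) (p : A * A * A) : A * A * A :=
  odflt (tone e)
    [pick q in Gtilde e | (tmul e p q == tone e) && (tmul e q p == tone e)].

Definition rho (e : A) (p : A * A * A) (x : A) : A :=
  let: (t, a, b) := p in t * a * x * inv_at e b * inv_at e t.

(* Since t, a and b lie in eAe, x |-> l (rho(p^-1)(x)) already vanishes on    *)
(* eJe', e'Je and e'Je' (e' = 1 - e), so it is an element of J_e^*.           *)
Definition rho_dual (e : A) (p : A * A * A) (l : {ffun J -> k}) :
    {ffun J -> k} :=
  [ffun x => evJ l (rho e (tinv e p) (inJ x))].

Definition dual_orbit (e : A) (l : {ffun J -> k}) : {set {ffun J -> k}} :=
  [set rho_dual e p l | p in Gtilde e].

Definition is_dual_orbit (e : A) (om : {set {ffun J -> k}}) : Prop :=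
  exists2 l, l \in Jdual_at e & om = dual_orbit e l.

Definition regular_at (e : A) (l : {ffun J -> k}) : Prop :=
  l \in Jdual_at e /\
  forall f : A, idem f -> e * f * e = f -> f != e -> l \notin Jdual_at f.

Definition n_right_orbits (f : A) (Om : {set {ffun J -> k}}) : nat :=
  #|[set [set mulr_dual m a | a in Nat f] | m in Om]|.

Definition associated (a b : A) : Prop :=
  exists u v, [/\ u \in kH, v \in kH, u * v = 1, v * u = 1 & a = u * b].

Definition Hfix (e : A) : {set hT} := [set h | inH h * e == e].

Fact Hfix_group_set e : group_set (Hfix e).
Proof.
apply/group_setP; split; first by rewrite inE inH1 mul1r.
move=> g h; rewrite !inE => /eqP ge /eqP he.
by rewrite inHM -mulrA he ge.
Qed.
Canonical Hfix_group e := Group (Hfix_group_set e).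

End TriangularAlgebra.

Arguments inH {k hT T} h.
Arguments gdelta {k hT} h.

Record addChar (k : finFieldType) := AddChar {
  addChar_fun :> k -> algC;
  addChar0 : addChar_fun 0 = 1;
  addCharD : {morph addChar_fun : a b / a + b >-> a * b};
  addChar_nontriv : exists a, addChar_fun a != 1
}.

(* As a class function, si_theta is 0 outside H(e), so its value at an        *)
(* arbitrary h : hT is the extension by zero.                                 *)
Record superIndex (k : finFieldType) (hT : finGroupType)
    (T : triangularDatum k hT) := SuperIndex {
  si_e : triAlg T;
  si_theta : 'CF(Hfix si_e);
  si_omega : {set {ffun tJ T -> k}};
  si_idem : idem si_e;
  si_kH : si_e \in kH T;
  si_lin : si_theta \is a linear_char;
  si_orbit : is_dual_orbit si_e si_omega;
  si_regular : forall l, l \in si_omega -> regular_at si_e l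
}.

Section Supercharacter.

Context {k : finFieldType} {hT : finGroupType} {T : triangularDatum k hT}.
Variables (eps : addChar k) (al : superIndex T).

Local Notation J := (tJ T).
Local Notation A := (triAlg T).
Local Notation e := (si_e al).

Definition Jright (l : {ffun J -> k}) : {set J} :=
  [set x | [forall y, l (mulJ x y) == 0]].

Definition Glam (l : {ffun J -> k}) : {set {unit A}} :=
  [set Gelt h x | h in Hfix e, x in Jright l].

(* Only meaningful on G, where u = h + x determines h. *)
Definition Hpart (u : {unit A}) : hT :=
  odflt 1%g [pick h | (val u).1 == gdelta h].

Definition xi_fun (l : {ffun J -> k}) (u : {unit A}) : algC :=
  if u \in Glam l then si_theta al (Hpart u) * eps (evJ l (val u)) else 0.

Lemma HpartE h x : Hpart (Gelt h x) = h.
Proof.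
rewrite /Hpart val_Gelt /=; case: pickP => [g /eqP/gdelta_inj|/(_ h)] //.
by rewrite eqxx.
Qed.

Section Lambda.

Variables (l : {ffun J -> k}) (l_om : l \in si_omega al).

Lemma Jdual_lin : linear (l : J -> k^o).
Proof.
have [+ _] := si_regular l_om; rewrite !inE => /andP[/forallP ll _] a x y.
by have /forallP/(_ x)/forallP/(_ y)/eqP := ll a.
Qed.

Lemma evJ_idem x : evJ l (e * inJ x * e) = l x.
Proof.
have [+ _] := si_regular l_om; rewrite !inE => /andP[_ /forallP/(_ x)].
case/and3P=> /eqP l1 /eqP l2 /eqP l3.
have evD u v : evJ l (u + v) = evJ l u + evJ l v.
  by rewrite /evJ /= (linear_add Jdual_lin).
have -> : l x = evJ l ((e + (1 - e)) * inJ x * (e + (1 - e))).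
  by rewrite addrC subrK mul1r mulr1.
by rewrite mulrDl mulrDl mulrDr [(1 - e) * _ * _]mulrDr !evD l1 l2 l3 !addr0.
Qed.

Lemma Hfix_commute h : h \in Hfix e -> e * inH h = e.
Proof.
rewrite inE => /eqP he; rewrite -[RHS]he.
have := si_kH al; rewrite inE; case: (e) => a y /= /eqP->.
rewrite !triME /triMul /= gract_delta glact_delta !glact0 !gract0.
rewrite (linear_zero (lact_lin h)) (linear_zero (ract_lin h)).
congr (_, _); apply/ffunP=> g; rewrite !ffunE.
have C x z : (x * z)%g = (z * x)%g :> hT.
  by apply: (centsP (hT_abelian T)); rewrite inE.
rewrite (bigD1 (g * h^-1)%g) //= [RHS](bigD1 h) //= !ffunE invMg invgK eqxx.
rewrite -mulgA mulVg mulg1 eqxx mulr1 mul1r C !big1 ?addr0 // => i ih.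
  by rewrite ffunE (negPf ih) mul0r.
rewrite ffunE; case: eqP => [E|]; last by rewrite mulr0.
by case/eqP: ih; rewrite -E invMg invgK C mulKVg.
Qed.

Lemma l_lact h x : h \in Hfix e -> l (lactJ h x) = l x.
Proof.
by move=> he; rewrite -!evJ_idem -inHJ mulrA Hfix_commute.
Qed.

Lemma l_ract h x : h \in Hfix e -> l (ractJ x h) = l x.
Proof.
rewrite inE => /eqP he; rewrite -!evJ_idem -inJH; congr evJ.
by rewrite -!mulrA he.
Qed.

Lemma Jright_mul h1 h2 x1 x2 : h1 \in Hfix e -> h2 \in Hfix e ->
  x1 \in Jright l -> x2 \in Jright l ->
  lactJ h1 x2 + ractJ x1 h2 + mulJ x1 x2 \in Jright l.
Proof.
move=> h1e h2e; rewrite !inE => /forallP x1r /forallP x2r; apply/forallP => y.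
rewrite !(linear_add (mulJ_linl y)) !(linear_add Jdual_lin).
rewrite -lact_mulJ l_lact // -mulJ_lact -mulJA.
by rewrite (eqP (x1r _)) (eqP (x1r _)) (eqP (x2r _)) !addr0.
Qed.

Fact Glam_group_set : group_set (Glam l).
Proof.
apply/group_setP; split.
  rewrite -Gelt1; apply: imset2_f; first exact: (group1 (Hfix_group e)).
  rewrite inE; apply/forallP => y.
  by rewrite (linear_zero (mulJ_linl y)) (linear_zero Jdual_lin).
move=> _ _ /imset2P[h1 x1 h1e x1r ->] /imset2P[h2 x2 h2e x2r ->].
rewrite GeltM; apply: imset2_f; first exact: (groupM (G := Hfix_group e)).
exact: Jright_mul.
Qed.
Definition Glam_group : {group {unit A}} := Group Glam_group_set.

Lemma xi_funM : {in Glam l &, {morph xi_fun l : u v / (u * v)%g >-> u * v}}.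
Proof.
move=> u v uG vG; have uvG : (u * v)%g \in Glam l.
  exact: (groupM (G := Glam_group)).
rewrite /xi_fun uvG uG vG.
have /imset2P[h1 x1 h1e x1r ->] := uG; have /imset2P[h2 x2 h2e x2r ->] := vG.
rewrite GeltM !HpartE (lin_charM (si_lin al)) // mulrACA -addCharD.
congr (_ * eps _); rewrite /evJ !val_Gelt /= !(linear_add Jdual_lin).
rewrite l_lact // l_ract //.
by move: x1r; rewrite inE => /forallP/(_ x2)/eqP->; rewrite addr0 addrC.
Qed.

Fact xi_subproof : is_class_fun <<Glam_group>>%g [ffun u => xi_fun l u].
Proof.
rewrite genGid; apply: intro_class_fun => [u v uG vG|u uG]; last first.
  by rewrite /xi_fun (negPf uG).
rewrite conjgE; have vVG : (v^-1)%g \in Glam l by rewrite (groupV Glam_group).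
have uvG : (u * v)%g \in Glam l by apply: (groupM (G := Glam_group)).
rewrite !xi_funM // mulrCA -xi_funM // mulVg -xi_funM ?mulg1 //.
exact: (group1 Glam_group).
Qed.
Definition xi : 'CF(Glam_group) := Cfun 0 xi_subproof.

Definition supchar : 'CF(triG T) := 'Ind[triG T, Glam_group] xi.

End Lambda.

End Supercharacter.

(* Main.v *)
(* Inducing from G_lambda, the value at h + x is an average of xi over the *)
(* conjugates by u s, with s in H and u in 1 + J. A conjugate contributes iff *)
(* mu = lambda u satisfies mu f' = 0 and mu x_s = 0, where x_s = s x s^-1, and it *)
(* then contributes theta(h) eps(mu(x_s)). The condition mu f' = 0 cuts lambda N *)
(* down to lambda N_f. The condition mu x_s = 0 is detected by orthogonality: *)
(* the sum of eps(mu(x_s b)) over b in N_f is |J_f| eps(mu(x_s)) or 0. What *)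
(* remains is a sum over s and over both sides of N_f, i.e. an average over the *)
(* group whose orbit of lambda is Omega; all right N_f-orbits in Omega have the *)
(* same size |Omega| / n(Omega). *)
Require Import Defs.
From HB Require Import structures.
From mathcomp Require Import all_boot all_order all_algebra all_fingroup.
From mathcomp Require Import all_solvable all_field all_character.
From mathcomp Require Import ring.

Set Implicit Arguments.
Unset Strict Implicit.
Unset Printing Implicit Defensive.

Import GRing.Theory Num.Theory.
Local Open Scope ring_scope.

(** * Sums over orbits and additive characters *)

(** The conjugating elements are written r = u s ([sum_triG]): s first turns x into x_s, then u
    moves lambda to mu = lambda u, and [xi_fun_conj] extracts the two conditions on mu. Each mu
    arises from |J_{lambda,right}| elements u ([card_orbit_Jright]); [orbit_Ksub_fixed] keeps the mu
    in lambda N_f, and [sum_Usub_right] detects mu x_s = 0. [dual_orbitE] identifies Omega with an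
    orbit of the group D of pairs of units in [Dsub], so that [sum_Dsub_value] and [sum_over_orbit]
    turn the remaining sum over s, mu and w into the sum of eps(mu(x)) over Omega.

    For the constants, |G_lambda| = |H(e)| |J_{lambda,right}|, |D| = |H| |J_f|^2, |H| = |H_e| |H(e)|
    and |Omega| = n(Omega) |lambda N_f|; everything cancels except |H_e| / n(Omega). *)

Section OrbitAverage.

Variables (gT : finGroupType) (S : finType) (to : {action gT &-> S}).
Variables (G : {group gT}).

(** The sum over G is the same for every base point in the orbit, and each g permutes the orbit, so
    both sides equal the double sum of F (to y g) over y and g. *)
Lemma sum_over_orbit (F : S -> algC) (x : S) :
  #|orbit to G x|%:R * \sum_(g in G) F (to x g) =
  #|G|%:R * \sum_(y in orbit to G x) F y.
Proof.
have E y : y \in orbit to G x ->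
    \sum_(g in G) F (to y g) = \sum_(g in G) F (to x g).
  case/orbitP=> b Gb <-; rewrite [RHS](reindex_inj (mulgI b)) /=.
  by apply: eq_big => [g|g _]; rewrite ?groupMl // actM.
transitivity (\sum_(y in orbit to G x) \sum_(g in G) F (to y g)).
  by rewrite (eq_bigr _ E) sumr_const mulr_natl.
rewrite exchange_big /= mulr_natl -sumr_const; apply: eq_bigr => g Gg.
rewrite [RHS](reindex_inj (act_inj to g)) /=; apply: eq_bigl => y.
by rewrite orbit_actr.
Qed.

(** As G normalises K, acting by g carries the K-orbit of x onto that of x g, so all K-orbits inside
    the G-orbit have the same size. *)
Lemma card_orbits_mul (K : {group gT}) (x : S) : K \subset G ->
  G \subset 'N(K)%g ->
  (#|[set orbit to K y | y in orbit to G x]| * #|orbit to K x|)%N =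
  #|orbit to G x|.
Proof.
move=> sKG nKG; rewrite -(@acts_sum_card_orbit _ _ _ to K (orbit to G x));
  last first.
  apply/actsP=> a Ka y; rewrite orbit_actr //; exact: (subsetP sKG).
rewrite -sum_nat_const; apply: eq_bigr => _ /imsetP[_ /orbitP[g Gg <-] ->].
rewrite -{2}(normP (subsetP nKG g Gg)).
rewrite -[RHS](card_preimset _ (act_inj to g)); apply: eq_card => y.
by rewrite inE orbit_conjsg.
Qed.

End OrbitAverage.

Section AddChar.

Variables (k : finFieldType) (eps : addChar k).

(** Orthogonality of characters: if m is nonzero somewhere on W, translation by a suitable v
    permutes W and multiplies the sum by eps (m v), which is not 1. *)
Lemma addChar_subspace_sum (V : finLmodType k) (W : {set V}) (m : V -> k) :
  (forall a u v, m (a *: u + v) = a * m u + m v) ->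
  0 \in W -> (forall a u v, u \in W -> v \in W -> a *: u + v \in W) ->
  \sum_(w in W) eps (m w) = #|W|%:R * [forall w in W, m w == 0]%:R.
Proof.
move=> ml W0 WZ; have mD u v : m (u + v) = m u + m v.
  by have := ml 1 u v; rewrite scale1r mul1r.
have m0 : m 0 = 0.
  by have := ml (-1) 0 0; rewrite scaler0 addr0 mulN1r addNr.
case: (boolP [forall w in W, m w == 0]) => [/forall_inP z|].
  rewrite mulr1 -sumr_const; apply: eq_bigr => w /z/eqP->.
  by rewrite addChar0.
rewrite negb_forall => /existsP[w]; rewrite negb_imply => /andP[Ww mw].
have [a ea] := addChar_nontriv eps; rewrite mulr0.
(* Scaled so that m v is the point a at which eps is nontrivial. *)
pose v := (a / m w) *: w; have Wv : v \in W.
  by have := WZ (a / m w) w 0 Ww W0; rewrite addr0.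
have mv : m v = a.
  by have := ml (a / m w) w 0; rewrite addr0 m0 addr0 -mulrA mulVf // mulr1.
have WE u : (v + u \in W) = (u \in W).
  apply/idP/idP => [vu|Wu]; last first.
    by have := WZ 1 v u Wv Wu; rewrite scale1r.
  by have := WZ (-1) v (v + u) Wv vu; rewrite scaleN1r addKr.
set s := \sum_(i in W) _; have: eps a * s = s.
  rewrite {2}/s (reindex_inj (addrI v)) /= mulr_sumr.
  apply: eq_big => [u|u _]; first by rewrite WE.
  by rewrite mD mv addCharD.
move/eqP; rewrite -subr_eq0 -{2}[s]mul1r -mulrBl mulf_eq0 subr_eq0 (negPf ea).
by move/eqP.
Qed.

End AddChar.

(** * The algebra A and the action of pairs of units on J^* *)

Section Basics.

Context {k : finFieldType} {hT : finGroupType} {T : triangularDatum k hT}.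

Local Notation J := (tJ T).
Local Notation A := (triAlg T).

Lemma hT_mulC (g h : hT) : (g * h = h * g)%g.
Proof. by apply: (centsP (hT_abelian T)); rewrite inE. Qed.

Lemma gconvC (a b : {ffun hT -> k}) : gconv a b = gconv b a.
Proof.
apply/ffunP=> g; rewrite !ffunE [RHS](reindex_inj invg_inj) /=.
rewrite [RHS](reindex_inj (mulgI g^-1%g)) /=; apply: eq_bigr => h _.
by rewrite invgK invMg invgK mulrC -mulgA [(h * g)%g]hT_mulC mulKg.
Qed.

Lemma kHP (c : A) : c \in kH T -> c = (c.1, 0).
Proof. by rewrite inE; case: c => a x /= /eqP->. Qed.

Lemma kH_comm (c d : A) : c \in kH T -> d \in kH T -> c * d = d * c.
Proof.
move/kHP=> -> /kHP->; rewrite !triME /triMul /= gconvC !glact0 !gract0.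
by rewrite !(linear_zero (mulJ_linl 0)).
Qed.

Lemma inH_kH h : inH h \in kH T.
Proof. by rewrite inE. Qed.

Lemma kH1 : 1 \in kH T. Proof. by rewrite inE. Qed.

Lemma kHB (c d : A) : c \in kH T -> d \in kH T -> c - d \in kH T.
Proof.
rewrite !inE => /eqP c0 /eqP d0.
by rewrite -[(c - d).2]/(c.2 - d.2) c0 d0 subrr.
Qed.

Lemma inJK (c : A) : c.1 = 0 -> inJ c.2 = c.
Proof. by case: c => a x /= ->. Qed.

Lemma fst_mulJl (c d : A) : c.1 = 0 -> (c * d).1 = 0.
Proof.
rewrite triME /= => ->; apply/ffunP=> g; rewrite !ffunE big1 // => h _.
by rewrite ffunE mul0r.
Qed.

Lemma fst_mulJr (c d : A) : d.1 = 0 -> (c * d).1 = 0.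
Proof.
rewrite triME /= => ->; apply/ffunP=> g; rewrite !ffunE big1 // => h _.
by rewrite ffunE mulr0.
Qed.

Lemma fst_mulJ (c d : A) x : (c * inJ x * d).1 = 0.
Proof. by apply: fst_mulJl; apply: fst_mulJr. Qed.

Lemma inJ0 : inJ (0 : J) = 0. Proof. by []. Qed.

Section Linear.

Variables (l : {ffun J -> k}) (lJ : l \in Jdual T).

Lemma JdualZ a x y : l (a *: x + y) = a * l x + l y.
Proof.
by move: lJ; rewrite inE => /forallP/(_ a)/forallP/(_ x)/forallP/(_ y)/eqP.
Qed.

Lemma evJ0 : evJ l (0 : A) = 0.
Proof. exact: (@linear_zero _ _ k^o _ JdualZ). Qed.

Lemma evJD (c d : A) : evJ l (c + d) = evJ l c + evJ l d.
Proof. exact: (@linear_add _ _ k^o _ JdualZ). Qed.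

Lemma evJB (c d : A) : evJ l (c - d) = evJ l c - evJ l d.
Proof. by apply/eqP; rewrite eq_sym subr_eq -evJD subrK. Qed.

(** [evJ] reads only the J-component, so it is additive on all of A; computations with l may pass
    through elements outside J, such as 1 or a unit. *)
Lemma evJ1 : evJ l (1 : A) = 0.
Proof. exact: evJ0. Qed.

End Linear.

Lemma Jdual_atW (e : A) l : l \in Jdual_at e -> l \in Jdual T.
Proof. by rewrite inE => /andP[]. Qed.

(** Peirce decomposition: c is the sum of e c e and three pieces on which l vanishes. Conversely,
    compression by e kills those pieces because e (1 - e) = 0. *)
Lemma Jdual_atP (e : A) l : idem e ->
  reflect (l \in Jdual T /\ forall c : A, c.1 = 0 -> evJ l (e * c * e) = evJ l
    c)
    (l \in Jdual_at e).
Proof.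
move/eqP=> ee; apply: (iffP idP) => [le|[lJ H]].
  have lJ := Jdual_atW le; split=> // c c0.
  move: le; rewrite inE lJ => /forallP/(_ c.2); rewrite inJK //.
  case/and3P=> /eqP l1 /eqP l2 /eqP l3.
  have {2}-> : c = (e + (1 - e)) * c * (e + (1 - e)).
    by rewrite addrC subrK mul1r mulr1.
  by rewrite mulrDl mulrDl mulrDr [(1 - e) * _ * _]mulrDr !evJD // l1 l2 l3
    !addr0.
rewrite inE lJ; apply/forallP=> x.
have e0 : e * (1 - e) = 0 by rewrite mulrBr mulr1 ee subrr.
have e0' : (1 - e) * e = 0 by rewrite mulrBl mul1r ee subrr.
apply/and3P; split; rewrite -H ?fst_mulJ //.
- by rewrite -!mulrA e0' !mulr0 evJ0.
- by rewrite !mulrA e0 !mul0r evJ0.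
- by rewrite !mulrA e0 !mul0r evJ0.
Qed.

Lemma evJ_idl (e c : A) l : idem e -> l \in Jdual_at e -> c.1 = 0 ->
  evJ l (e * c) = evJ l c.
Proof.
move=> ie /(Jdual_atP _ ie)[_ H] c0.
by rewrite -H ?fst_mulJr // mulrA (eqP ie) H.
Qed.

Lemma evJ_idr (e c : A) l : idem e -> l \in Jdual_at e -> c.1 = 0 ->
  evJ l (c * e) = evJ l c.
Proof.
move=> ie /(Jdual_atP _ ie)[_ H] c0.
by rewrite -H ?fst_mulJl // -!mulrA (eqP ie) mulrA H.
Qed.

(* Letting pairs of units of A act, instead of the group of triples attached *)
(* to an idempotent, gives one total right action serving all idempotents. *)
Definition dact (l : {ffun J -> k}) (d : {unit A} * {unit A}) :=
  [ffun x => evJ l (val d.1 * inJ x * val d.2^-1%g)] : {ffun J -> k}.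

Lemma evJ_dact l d c : c.1 = 0 ->
  evJ (dact l d) c = evJ l (val d.1 * c * val d.2^-1%g).
Proof. by move=> c0; rewrite {1}/evJ ffunE inJK. Qed.

Fact dact_is_action : is_action [set: {unit A} * {unit A}] dact.
Proof.
apply: is_total_action => [l|l d d'].
  apply/ffunP=> x; rewrite ffunE; have -> : (1 : {unit A} * {unit A})%g.2 = 1%g
    by [].
  rewrite invg1.
  by have -> : \val (1%g : {unit A}) = 1 by []; rewrite mul1r mulr1.
apply/ffunP=> x; rewrite [LHS]ffunE [RHS]ffunE evJ_dact ?fst_mulJ //.
have -> : (d * d').2%g = (d.2 * d'.2)%g by [].
by rewrite invMg !FinRing.val_unitM !mulrA.
Qed.
Canonical dact_action := Action dact_is_action.

Lemma glact0l (x : J) : glact 0 x = 0.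
Proof. by rewrite /glact big1 // => h _; rewrite ffunE scale0r. Qed.

Lemma gract0l (x : J) : gract x 0 = 0.
Proof. by rewrite /gract big1 // => h _; rewrite ffunE scale0r. Qed.

Lemma mulAJ_linear (c d : A) : linear (fun x : J => (c * inJ x * d).2).
Proof.
have lc (e : A) : linear (fun x => (e * inJ x).2).
  move=> a x y; rewrite !triME /triMul /= !gract0l !addr0.
  rewrite (mulJ_linr _ a x y) scalerDr addrACA; congr (_ + _).
  rewrite /glact scaler_sumr -big_split; apply: eq_bigr => h _ /=.
  by rewrite (lact_lin h a x y) scalerDr !scalerA mulrC.
have ld (e : A) : linear (fun x => (inJ x * e).2).
  move=> a x y; rewrite !triME /triMul /= !glact0l !add0r.
  rewrite (mulJ_linl _ a x y) scalerDr addrACA; congr (_ + _).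
  rewrite /gract scaler_sumr -big_split; apply: eq_bigr => h _ /=.
  by rewrite (ract_lin h a x y) scalerDr !scalerA mulrC.
have E x : (c * inJ x * d).2 = (inJ (c * inJ x).2 * d).2.
  by rewrite inJK ?fst_mulJr.
by move=> a x y; rewrite !E lc ld.
Qed.

Lemma dact_Jdual l d : l \in Jdual T -> dact l d \in Jdual T.
Proof.
move=> lJ; rewrite inE; apply/forallP=> a; apply/forallP=> x.
apply/forallP=> y; rewrite !ffunE /evJ (mulAJ_linear _ _ a x y).
by rewrite (JdualZ lJ).
Qed.

End Basics.

(** * The corner group G_f *)

Section Corner.

Context {k : finFieldType} {hT : finGroupType} {T : triangularDatum k hT}.

Local Notation J := (tJ T).
Local Notation A := (triAlg T).
Local Notation uA := {unit triAlg T}.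

Lemma lactJ0 h : lactJ h (0 : J) = 0. Proof. exact: linear_zero (lact_lin h).
  Qed.
Lemma ractJ0 h : ractJ (0 : J) h = 0. Proof. exact: linear_zero (ract_lin h).
  Qed.
Lemma mul0J x : mulJ (0 : J) x = 0. Proof. exact: linear_zero (mulJ_linl x).
  Qed.
Lemma mulJ0 x : mulJ x (0 : J) = 0. Proof. exact: linear_zero (mulJ_linr x).
  Qed.

(* J_f = f J f, as a subset of J. *)
Definition Jsub (f : A) : {set J} :=
  [set v | (f * inJ v == inJ v) && (inJ v * f == inJ v)].

Lemma JsubP (f : A) v :
  reflect (f * inJ v = inJ v /\ inJ v * f = inJ v) (v \in Jsub f).
Proof. by rewrite inE; apply: (iffP andP) => -[/eqP-> /eqP->]. Qed.

Lemma Jsub0 f : 0 \in Jsub f.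
Proof. by apply/JsubP; rewrite inJ0 mulr0 mul0r. Qed.

Lemma JsubD f v w : v \in Jsub f -> w \in Jsub f -> v + w \in Jsub f.
Proof.
by move=> /JsubP[v1 v2] /JsubP[w1 w2]; apply/JsubP; rewrite inJD mulrDr mulrDl
  v1 v2 w1 w2.
Qed.

Lemma JsubM f v w : v \in Jsub f -> w \in Jsub f -> mulJ v w \in Jsub f.
Proof.
move=> /JsubP[v1 v2] /JsubP[w1 w2]; apply/JsubP; rewrite -inJM; split.
  by rewrite mulrA v1.
by rewrite -mulrA w2.
Qed.

Lemma JsubZD f a v w : v \in Jsub f -> w \in Jsub f -> a *: v + w \in Jsub f.
Proof.
move=> vf wf; apply: JsubD => //; move/JsubP: vf => [v1 v2].
have := mulAJ_linear f 1 a v 0; have := mulAJ_linear 1 f a v 0.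
rewrite !addr0 !mulr1 !mul1r v1 v2 inJ0 mulr0 mul0r.
have -> : (0 : A).2 = 0 by []; rewrite !addr0 => E1 E2; apply/JsubP; split.
  by rewrite -[LHS]inJK ?fst_mulJr // E2.
by rewrite -[LHS]inJK ?fst_mulJl // E1.
Qed.

Lemma Jsub1 v : v \in Jsub 1.
Proof. by apply/JsubP; rewrite mul1r mulr1. Qed.

(* 1 + J_f consists of units of A and acts on J_f^* as N_f = f + J_f does. *)
Definition Usub (f : A) : {set uA} := [set Gelt 1%g v | v in Jsub f].

Lemma val_GeltE h x : val (Gelt h x : uA) = inH h + inJ x. Proof. by []. Qed.

Lemma Gelt_inj h1 h2 (x1 x2 : J) : Gelt h1 x1 = Gelt h2 x2 -> h1 = h2 /\ x1 =
  x2.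
Proof.
move/(congr1 val); rewrite !val_Gelt => E.
by split; [apply: (@gdelta_inj k); apply: (congr1 fst E) | apply: (congr1 snd
  E)].
Qed.

Fact Usub_group_set f : group_set (Usub f).
Proof.
apply/group_setP; split; first by rewrite -Gelt1 imset_f ?Jsub0.
move=> _ _ /imsetP[v vf ->] /imsetP[w wf ->]; rewrite GeltM mulg1 lact1 ract1.
by rewrite imset_f // !JsubD ?JsubM.
Qed.
Canonical Usub_group f := Group (Usub_group_set f).

Lemma card_Usub f : #|Usub f| = #|Jsub f|.
Proof. by rewrite card_imset // => v w /Gelt_inj[]. Qed.

Lemma sum_Usub f (F : uA -> algC) :
  \sum_(u in Usub f) F u = \sum_(v in Jsub f) F (Gelt 1%g v).
Proof. by rewrite big_imset // => v w _ _ /Gelt_inj[]. Qed.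

Section Idempotent.

Variables (f : A) (ff : idem f) (f_kH : f \in kH T).

Lemma f_inH s : f * inH s = inH s * f.
Proof. exact: kH_comm f_kH (inH_kH s). Qed.

Lemma Jsub_lact s v : v \in Jsub f -> lactJ s v \in Jsub f.
Proof.
by case/JsubP=> v1 v2; apply/JsubP; rewrite -inHJ mulrA f_inH -!mulrA v1 v2.
Qed.

Lemma Jsub_ract s v : v \in Jsub f -> ractJ v s \in Jsub f.
Proof.
case/JsubP=> v1 v2; apply/JsubP; rewrite -inJH; split;
  first by rewrite mulrA v1.
by rewrite -mulrA -f_inH mulrA v2.
Qed.

Definition Gsub : {set uA} := [set Gelt s v | s in [set: hT], v in Jsub f].

Lemma Gsub_group_set : group_set Gsub.
Proof.
apply/group_setP; split.
  by rewrite -Gelt1; apply: imset2_f; rewrite ?Jsub0 // inE.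
move=> _ _ /imset2P[s v _ vf ->] /imset2P[t w _ wf ->]; rewrite GeltM.
apply: imset2_f; first by rewrite inE.
by rewrite !JsubD ?JsubM ?Jsub_lact ?Jsub_ract.
Qed.
Definition Gsub_group := Group Gsub_group_set.

Lemma Gsub_Gelt s v : v \in Jsub f -> Gelt s v \in Gsub.
Proof. by move=> vf; apply: imset2_f; rewrite // inE. Qed.

Lemma Usub_Gsub : Usub f \subset Gsub.
Proof. by apply/subsetP=> _ /imsetP[v vf ->]; apply: Gsub_Gelt. Qed.

Lemma GeltH0M s v : (Gelt s 0 * Gelt 1 v)%g = Gelt s (lactJ s v) :> uA.
Proof.
by rewrite GeltM mulg1 ractJ0 mul0J !addr0.
Qed.

Lemma GeltMH0 s v : (Gelt 1 v * Gelt s 0)%g = Gelt s (ractJ v s) :> uA.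
Proof.
by rewrite GeltM mul1g lactJ0 mulJ0 addr0 add0r.
Qed.

Lemma GeltH0V s : ((Gelt s 0)^-1)%g = Gelt s^-1%g 0 :> uA.
Proof.
by apply/eqP; rewrite eq_invg_mul GeltM mulgV ractJ0 lactJ0 mulJ0 !addr0 Gelt1.
Qed.

Lemma Gelt_decomp s v : v \in Jsub f ->
  exists2 u, u \in Usub f & Gelt s v = (Gelt s 0 * u)%g.
Proof.
move=> vf; exists (Gelt 1%g (lactJ s^-1%g v));
  first by rewrite imset_f ?Jsub_lact.
by rewrite GeltH0M -lactM mulgV lact1.
Qed.

Lemma Gsub_norm : Gsub \subset 'N(Usub f)%g.
Proof.
apply/subsetP=> _ /imset2P[s v _ vf ->]; have [u uU ->] := Gelt_decomp s vf.
apply: groupM; last exact: (subsetP (normG (Usub_group f)) u uU).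
rewrite inE; apply/subsetP=> _ /imsetP[_ /imsetP[w wf ->] ->].
rewrite conjgE GeltH0V mulgA GeltM mulg1 GeltM.
rewrite mulVg !(lactJ0, ractJ0, mul0J, mulJ0) !addr0.
by rewrite add0r; apply: imset_f; rewrite Jsub_ract ?Jsub_lact.
Qed.

Lemma Gsub_comm u : u \in Gsub -> f * val u = val u * f.
Proof.
case/imset2P=> s v _ /JsubP[v1 v2] ->.
by rewrite val_GeltE mulrDl mulrDr f_inH v1 v2.
Qed.

(* u |-> f u maps H + J_f onto G_f = H_f + J_f and is multiplicative, so the *)
(* inverses in G_f, taken with respect to f, come from inverses of units. *)
Definition corner (u : uA) : A := f * val u.

Lemma cornerM u v : u \in Gsub -> corner u * corner v = corner (u * v)%g.
Proof.
move=> uG; rewrite /corner FinRing.val_unitM mulrA -(mulrA f) -Gsub_comm //.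
by rewrite !mulrA (eqP ff).
Qed.

Lemma corner1 : corner 1%g = f.
Proof. by rewrite /corner mulr1. Qed.

Lemma JatP (y : A) : reflect (exists2 v, v \in Jsub f & y = inJ v) (y \in Jat
  f).
Proof.
apply: (iffP imsetP) => [[x _ ->]|[v /JsubP[v1 v2] ->]]; last first.
  by exists v; rewrite ?inE // v1 v2.
have E := inJK (fst_mulJ f f x); exists (f * inJ x * f).2; last by rewrite E.
by apply/JsubP; rewrite E !mulrA (eqP ff) -!mulrA (eqP ff).
Qed.

Lemma corner_Gelt s v : v \in Jsub f -> corner (Gelt s v) = inH s * f + inJ v.
Proof. by case/JsubP=> v1 _; rewrite /corner val_GeltE mulrDr v1 f_inH. Qed.

Lemma GatP y : reflect (exists2 u, u \in Gsub & y = corner u) (y \in Gat f).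
Proof.
apply: (iffP imset2P) => [[_ _ /imsetP[s _ ->] /JatP[v vf ->] ->]|].
  by exists (Gelt s v); rewrite ?Gsub_Gelt ?corner_Gelt.
case=> _ /imset2P[s v _ vf ->] ->; rewrite corner_Gelt //.
exists (inH s * f) (inJ v) => //; first exact: imset_f.
by apply/JatP; exists v.
Qed.

Lemma HatP y : reflect (exists s, y = corner (Gelt s 0)) (y \in Hat f).
Proof.
apply: (iffP imsetP) => [[s _ ->]|[s ->]].
  by exists s; rewrite corner_Gelt ?Jsub0 // addr0.
by exists s; rewrite // corner_Gelt ?Jsub0 // addr0.
Qed.

Lemma NatP y : reflect (exists2 u, u \in Usub f & y = corner u) (y \in Nat f).
Proof.
apply: (iffP imsetP) => [[_ /JatP[v vf ->] ->]|].
  by exists (Gelt 1%g v); rewrite ?imset_f ?corner_Gelt // mul1r.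
case=> _ /imsetP[v vf ->] ->; rewrite corner_Gelt // mul1r.
by exists (inJ v) => //; apply/JatP; exists v.
Qed.

(** Inverses relative to the identity f are unique, so whatever [inv_at] picks is [corner u^-1]; as
    this candidate qualifies, the default 0 never occurs. *)
Lemma inv_at_corner u : u \in Gsub -> inv_at f (corner u) = corner u^-1%g.
Proof.
move=> uG; have VG : (u^-1)%g \in Gsub by rewrite (groupV Gsub_group).
rewrite /inv_at; case: pickP => [d /and3P[/GatP[w wG ->]]|/(_ (corner u^-1%g))].
  move=> _ /eqP/(congr1 ( *%R^~ (corner u^-1%g))) /=; rewrite -corner1.
  by rewrite !cornerM ?(groupM (G := Gsub_group)) ?(group1 Gsub_group) //=
    mulgK mul1g.
rewrite !cornerM // mulgV mulVg corner1 eqxx !andbT.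
by case/GatP; exists u^-1%g.
Qed.

Definition cornerT (g u w : uA) : A * A * A := (corner g, corner u, corner w).

Lemma GtildeP p :
  reflect (exists s u w, [/\ u \in Usub f, w \in Usub f & p = cornerT (Gelt s
    0) u w])
    (p \in Gtilde f).
Proof.
case: p => [[t a] b]; rewrite inE; apply: (iffP and3P) => /=.
  by case=> /HatP[s ->] /NatP[u uU ->] /NatP[w wU ->]; exists s, u, w.
case=> s [u] [w] [uU wU [-> -> ->]]; split; first by apply/HatP; exists s.
  by apply/NatP; exists u.
by apply/NatP; exists w.
Qed.

Lemma tmul_cornerT g u w g' u' w' :
  g \in Gsub -> u \in Gsub -> w \in Gsub -> g' \in Gsub ->
  tmul f (cornerT g u w) (cornerT g' u' w') =
    cornerT (g * g') (u ^ g' * u') (w ^ g' * w').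
Proof.
move=> gG uG wG gG'; have VG : (g'^-1)%g \in Gsub by rewrite (groupV
  Gsub_group).
rewrite /tmul /cornerT inv_at_corner // !conjgE.
by rewrite !cornerM ?(groupM (G := Gsub_group)) // !mulgA.
Qed.

(** Exhibits every triple as the inverse of an explicit one; since [rho_dual] acts through [tinv],
    this is what makes its orbits reach every triple. *)
Lemma tinv_cornerT s u w : u \in Usub f -> w \in Usub f ->
  let g := Gelt s 0 in
  tinv f (cornerT g^-1 (u^-1 ^ g^-1) (w^-1 ^ g^-1)) = cornerT g u w.
Proof.
move=> uU wU g.
have gG : g \in Gsub by rewrite Gsub_Gelt ?Jsub0.
have VG : (g^-1)%g \in Gsub by rewrite (groupV Gsub_group).
have uG := subsetP Usub_Gsub u uU; have wG := subsetP Usub_Gsub w wU.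
have uG' : (u^-1 ^ g^-1)%g \in Gsub by rewrite (groupJ (G := Gsub_group)) //
  (groupV Gsub_group).
have wG' : (w^-1 ^ g^-1)%g \in Gsub by rewrite (groupJ (G := Gsub_group)) //
  (groupV Gsub_group).
have T1 : cornerT 1%g 1%g 1%g = tone f by rewrite /cornerT corner1.
rewrite /tinv; case: pickP => [q|/(_ (cornerT g u w))]; last first.
  rewrite !tmul_cornerT // !conjgKV !mulVg mulgV -!conjMg !mulgV !conj1g T1
    eqxx !andbT.
  by have -> : cornerT g u w \in Gtilde f by apply/GtildeP; exists s, u, w.
(* The picked triple comes from units that may differ from g, u, w, because [corner] can identify
   distinct units; only corners are compared below. *)
case/and3P=> /GtildeP[t [u'] [w'] [uU' wU' ->]] /eqP + _ /=.
have tG : Gelt t 0 \in Gsub by rewrite Gsub_Gelt ?Jsub0.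
set h := Gelt t 0 in tG *.
have hVG : (h^-1)%g \in Gsub by rewrite (groupV Gsub_group).
have cancelV a b : a \in Gsub -> b \in Gsub -> corner (a^-1 * b)%g = f ->
    corner b = corner a.
  move=> aG bG /(congr1 ( *%R (corner a))); rewrite cornerM // mulKVg => ->.
  by rewrite -corner1 cornerM // mulg1.
rewrite tmul_cornerT // => -[E1 E2 E3].
have gh : corner h = corner g by apply: cancelV.
have ghV : corner h^-1 = corner g^-1 by rewrite -!inv_at_corner // gh.
have conjE a : a \in Gsub -> corner (a ^ h) = corner (a ^ g).
  by move=> aG; rewrite !conjgE -!cornerM ?(groupM (G := Gsub_group)) // ghV gh.
have fin a b : a \in Gsub -> b \in Gsub -> corner ((a^-1 ^ g^-1) ^ h * b)%g = f
  ->
    corner b = corner a.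
  move=> aG bG; have aVG : (a^-1)%g \in Gsub by rewrite (groupV Gsub_group).
  have aG' : (a^-1 ^ g^-1)%g \in Gsub by rewrite (groupJ (G := Gsub_group)).
  rewrite -cornerM ?(groupJ (G := Gsub_group)) // conjE // conjgKV cornerM //.
  exact: cancelV.
by rewrite /cornerT gh (fin u u') ?(fin w w') ?(subsetP Usub_Gsub).
Qed.

(** The product t a x b^-1 t^-1 is f (g u) x (g w)^-1 f, and a functional in J_f^* does not see the
    outer factors f. *)
Lemma rho_cornerT l g u w x : l \in Jdual_at f ->
  g \in Gsub -> u \in Gsub -> w \in Gsub ->
  evJ l (rho f (cornerT g u w) (inJ x)) = dact l (g * u, g * w)%g x.
Proof.
move=> lf gG uG wG; rewrite ffunE /rho /cornerT !inv_at_corner //.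
have VG : (g^-1)%g \in Gsub by rewrite (groupV Gsub_group).
have wVG : (w^-1)%g \in Gsub by rewrite (groupV Gsub_group).
rewrite cornerM // -[LHS]/(evJ _ _) -(mulrA _ _ (corner g^-1)) cornerM //.
rewrite /corner (Gsub_comm (u := (w^-1 * g^-1)%g)) ?(groupM (G := Gsub_group))
  //.
rewrite -invMg !mulrA -!(mulrA f) mulrA.
by case: (Jdual_atP _ ff lf) => _ ->; rewrite ?fst_mulJ //= ?mulrA.
Qed.

End Idempotent.
End Corner.

(** * Orbits in J_f^* *)

Section Orbits.

Context {k : finFieldType} {hT : finGroupType} {T : triangularDatum k hT}.

Local Notation J := (tJ T).
Local Notation A := (triAlg T).
Local Notation uA := {unit triAlg T}.

(* The right action mu |-> mu a of N_f. *)
Definition Ksub (f : A) : {set uA * uA} := [set (u, 1%g) | u in Usub f].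

Fact Ksub_group_set f : group_set (Ksub f).
Proof.
apply/group_setP; split; first exact: (imset_f _ (group1 (Usub_group f))).
move=> _ _ /imsetP[u uU ->] /imsetP[w wU ->].
have -> : ((u, 1) * (w, 1) = ((u * w)%g, 1) :> uA * uA)%g.
  by rewrite -[LHS]/((u * w)%g, (1 * 1)%g) mulg1.
exact: (imset_f _ (groupM (G := Usub_group f) uU wU)).
Qed.
Canonical Ksub_group f := Group (Ksub_group_set f).

Lemma card_Ksub f : #|Ksub f| = #|Jsub f|.
Proof. by rewrite card_imset ?card_Usub // => u w []. Qed.

Lemma sum_Ksub f (F : uA * uA -> algC) :
  \sum_(d in Ksub f) F d = \sum_(u in Usub f) F (u, 1%g).
Proof. by rewrite big_imset // => u w _ _ []. Qed.

Lemma dactE (l : {ffun J -> k}) (u w : uA) x :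
  dact l (u, w) x = evJ l (val u * inJ x * val w^-1%g).
Proof. by rewrite ffunE. Qed.

Lemma dact_left (l : {ffun J -> k}) (u : uA) x :
  dact l (u, 1%g) x = evJ l (val u * inJ x).
Proof. by rewrite dactE invg1 mulr1. Qed.

Lemma evJ_dact_left (l : {ffun J -> k}) (u : uA) (c : A) : c.1 = 0 ->
  evJ (dact l (u, 1%g)) c = evJ l (val u * c).
Proof. by move=> c0; rewrite {1}/evJ dact_left inJK. Qed.

(** Orbit-stabiliser: l (1 + v) = l iff l v = 0, so the stabiliser of l in 1 + J is 1 +
    J_{l,right}. *)
Lemma card_orbit_Jright (l : {ffun J -> k}) : l \in Jdual T ->
  (#|orbit dact_action (Ksub 1%R) l| * #|Jright l|)%N = #|Jsub (1%R : A)|.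
Proof.
move=> lJ; rewrite -card_Ksub -(card_orbit_stab dact_action (Ksub_group 1) l).
congr (_ * _)%N; rewrite -(card_imset (f := fun v => (Gelt 1%g v, 1%g : uA))).
  apply: eq_card => d; rewrite inE.
  apply/imsetP/andP => [[v vr ->]|[/imsetP[_ /imsetP[v _ ->] ->] /astab1P E]].
    split; first exact/imset_f/imset_f/Jsub1.
    apply/astab1P/ffunP=> x; rewrite [LHS]dact_left val_GeltE inH1 mulrDl mul1r.
    rewrite evJD // inJM; move: vr; rewrite inE => /forallP/(_ x)/eqP vr.
    by rewrite -[evJ l (inJ (mulJ v x))]/(l (mulJ v x)) vr addr0.
  exists v => //; rewrite inE; apply/forallP=> x.
  have := congr1 (fun m : {ffun T -> k} => m x) E.
  rewrite [dact_action _ _ _]dact_left val_GeltE inH1 mulrDl mul1r evJD // inJM.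
  by move/eqP; rewrite addrC -subr_eq0 addrK.
by move=> v w E; have [] := Gelt_inj (congr1 fst E).
Qed.

Lemma sum_Usub1 (l : {ffun J -> k}) (F : {ffun J -> k} -> algC) : l \in Jdual T
  ->
  \sum_(u in Usub (1 : A)) F (dact l (u, 1%g)) =
  #|Jright l|%:R * \sum_(m in orbit dact_action (Ksub 1%R) l) F m.
Proof.
move=> lJ; rewrite -(sum_Ksub 1 (fun d => F (dact l d))).
have := sum_over_orbit dact_action (Ksub_group 1) F l.
rewrite card_Ksub -(card_orbit_Jright lJ) natrM -mulrA; apply: mulfI.
by rewrite pnatr_eq0 -lt0n; apply/card_gt0P; exists l; apply: orbit_refl.
Qed.

Section Idempotent.

Variables (f : A) (ff : idem f) (f_kH : f \in kH T).

(* The pair (a h, b h) acts as a triple (t, a', b') with t = h f, where a' and *)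
(* b' are the conjugates of a and b by h, pushed into the corner by f. *)
Definition Dpair (p : hT * uA * uA) : uA * uA :=
  (p.1.2 * Gelt p.1.1 0, p.2 * Gelt p.1.1 0)%g.
Definition Dsub : {set uA * uA} :=
  Dpair @: setX (setX [set: hT] (Usub f)) (Usub f).

Lemma DsubP d :
  reflect (exists s u w, [/\ u \in Usub f, w \in Usub f & d = Dpair (s, u, w)])
    (d \in Dsub).
Proof.
apply: (iffP imsetP) => [[[[s u] w]]|[s [u [w [uU wU ->]]]]].
  by rewrite !inE /= => /andP[uU wU] ->; exists s, u, w.
by exists (s, u, w); rewrite // !inE /= uU wU.
Qed.

Lemma Usub_conjH s u : u \in Usub f -> (u ^ Gelt s 0)%g \in Usub f.
Proof.
move=> uU; rewrite memJ_norm //; apply: (subsetP (Gsub_norm f_kH)).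
by rewrite Gsub_Gelt ?Jsub0.
Qed.

Lemma Usub_conjHV s u : u \in Usub f -> (u ^ (Gelt s 0)^-1)%g \in Usub f.
Proof. by rewrite GeltH0V; apply: Usub_conjH. Qed.

Fact Dsub_group_set : group_set Dsub.
Proof.
apply/group_setP; split.
  apply/DsubP; exists 1%g, 1%g, 1%g; rewrite !(group1 (Usub_group f));
    split=> //.
  by rewrite /Dpair /= Gelt1 mulg1.
move=> _ _ /DsubP[s [u [w [uU wU ->]]]] /DsubP[t [u' [w' [uU' wU' ->]]]].
apply/DsubP; exists (s * t)%g, (u * u' ^ (Gelt s 0)^-1)%g, (w * w' ^ (Gelt s
  0)^-1)%g.
split; try by apply: (groupM (G := Usub_group f)) => //; apply: Usub_conjHV.
have E : Gelt (s * t)%g 0 = (Gelt s 0 * Gelt t 0)%g :> uA.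
  by rewrite GeltM lactJ0 ractJ0 mulJ0 !addr0.
rewrite /Dpair /= E -[LHS]/((_ * _)%g, (_ * _)%g); congr (_, _).
  by rewrite conjgE invgK !mulgA mulgKV.
by rewrite conjgE invgK !mulgA mulgKV.
Qed.
Definition Dsub_group := Group Dsub_group_set.

Lemma Dpair_inj :
  {in setX (setX [set: hT] (Usub f)) (Usub f) &, injective Dpair}.
Proof.
move=> [[s u] w] [[t u'] w']; rewrite !inE /=.
move=> /andP[/imsetP[v _ ->] _] /andP[/imsetP[v' _ ->] _] E.
have E1 : (Gelt 1 v * Gelt s 0 = Gelt 1 v' * Gelt t 0 :> uA)%g := congr1 fst E.
have E2 : (w * Gelt s 0 = w' * Gelt t 0)%g := congr1 snd E.
have st : s = t by move: E1; rewrite !GeltMH0 => /Gelt_inj[].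
by rewrite st in E1 E2 *; rewrite (mulIg _ _ _ E1) (mulIg _ _ _ E2).
Qed.

Lemma card_Dsub : #|Dsub| = (#|hT| * #|Jsub f| ^ 2)%N.
Proof.
by rewrite (card_in_imset Dpair_inj) !cardsX cardsT card_Usub -mulnA.
Qed.

Lemma sum_Dsub (F : uA * uA -> algC) :
  \sum_(d in Dsub) F d =
  \sum_s \sum_(u in Usub f) \sum_(w in Usub f) F (Dpair (s, u, w)).
Proof.
rewrite big_imset /=; last exact: Dpair_inj.
under [RHS]eq_bigr do rewrite pair_big_dep.
rewrite pair_big_dep /= (reindex (fun p : hT * (uA * uA) => (p.1, p.2.1,
  p.2.2))) /=.
  by apply: eq_bigl => -[s [u w]]; rewrite !inE.
by exists (fun p : hT * uA * uA => (p.1.1, (p.1.2, p.2))) => [[s [u w]]|[[s u]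
  w]].
Qed.

Lemma Ksub_Dsub : Ksub f \subset Dsub.
Proof.
apply/subsetP=> _ /imsetP[u uU ->]; apply/DsubP; exists 1%g, u, 1%g.
by rewrite (group1 (Usub_group f)) /Dpair /= Gelt1 !mulg1.
Qed.

Lemma Dsub_norm : Dsub \subset 'N(Ksub f)%g.
Proof.
apply/subsetP=> _ /DsubP[s [u [w [uU wU ->]]]].
rewrite inE; apply/subsetP=> _ /imsetP[_ /imsetP[a aU ->] ->].
rewrite -[X in X \in _]/((a ^ (u * Gelt s 0))%g, (1 ^ (w * Gelt s 0))%g) conj1g.
by rewrite conjgM imset_f // Usub_conjH // (groupJ (G := Usub_group f)).
Qed.

Lemma Dsub_comm d : d \in Dsub ->
  f * val d.1 = val d.1 * f /\ f * val d.2^-1%g = val d.2^-1%g * f.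
Proof.
case/DsubP=> s [u [w [uU wU ->]]].
have UG := subsetP (Usub_Gsub f).
have gG : Gelt s 0 \in Gsub f by rewrite Gsub_Gelt ?Jsub0.
have C := Gsub_comm f_kH; split; apply: C.
  by apply: (groupM (G := Gsub_group f_kH)); rewrite // UG.
rewrite (groupV (Gsub_group f_kH)).
by apply: (groupM (G := Gsub_group f_kH)); rewrite // UG.
Qed.

Lemma dact_Jdual_at l d : d \in Dsub -> l \in Jdual_at f ->
  dact l d \in Jdual_at f.
Proof.
move=> /Dsub_comm[c1 c2] /(Jdual_atP _ ff)[lJ H]; apply/(Jdual_atP _ ff).
split=> [|c c0]; first exact: dact_Jdual.
have fc (a b : A) : (a * c * b).1 = 0 by apply/fst_mulJl/fst_mulJr.
by rewrite !evJ_dact // -[RHS]H // !mulrA c1 -!mulrA c2.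
Qed.

(** A triple (g, u, w) acts as the pair (g u, g w) by [rho_cornerT]; moving g to the right
    conjugates u and w within 1 + J_f, which gives the shape required by [Dpair]. *)
Lemma dual_orbitE l : l \in Jdual_at f ->
  dual_orbit f l = orbit dact_action Dsub l.
Proof.
move=> lf; apply/setP=> m.
have gG s : Gelt s 0 \in Gsub f by rewrite Gsub_Gelt ?Jsub0.
have UG := subsetP (Usub_Gsub f).
have R s u w q : u \in Usub f -> w \in Usub f ->
    tinv f q = cornerT f (Gelt s 0) u w ->
    rho_dual f q l = dact l (Gelt s 0 * u, Gelt s 0 * w)%g.
  move=> uU wU E; apply/ffunP=> x; rewrite [LHS]ffunE E.
  by rewrite (rho_cornerT ff f_kH) ?gG // UG.
apply/imsetP/orbitP => [[p pG ->]|[_ /DsubP[s [u [w [uU wU ->]]]] <-]].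
  have : tinv f p \in Gtilde f.
    (* The default [tone] is itself a triple, so membership holds whether or not an inverse is
       found. *)
    rewrite /tinv; case: pickP => [q /andP[]|_] //=.
    apply/GtildeP=> //; exists 1%g, 1%g, 1%g; rewrite (group1 (Usub_group f)).
    by rewrite Gelt1 /cornerT corner1.
  case/GtildeP=> // s [u [w [uU wU E]]]; rewrite (R s u w) //.
  exists (Dpair (s, u ^ (Gelt s 0)^-1, w ^ (Gelt s 0)^-1)%g).
    by apply/DsubP; do 3![eexists]; split; last reflexivity; apply: Usub_conjHV.
  by rewrite /Dpair /= !conjgE invgK !mulgA !mulgKV.
have uU' := Usub_conjH s uU; have wU' := Usub_conjH s wU.
set u' := (u ^ _)%g in uU'; set w' := (w ^ _)%g in wU'.
exists (cornerT f (Gelt s 0)^-1 (u'^-1 ^ (Gelt s 0)^-1) (w'^-1 ^ (Gelt s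
  0)^-1)).
  apply/GtildeP=> //; rewrite GeltH0V; do 3![eexists]; split; last reflexivity.
    by rewrite Usub_conjH // (groupV (Usub_group f)).
  by rewrite Usub_conjH // (groupV (Usub_group f)).
rewrite (R s u' w') ?tinv_cornerT //.
by rewrite /Dpair /u' /w' !conjgE !mulgA !mulgV !mul1g.
Qed.

Lemma right_orbitE l : l \in Jdual_at f ->
  [set mulr_dual l a | a in Nat f] = orbit dact_action (Ksub f) l.
Proof.
move=> lf.
have E u : u \in Usub f -> mulr_dual l (corner f u) = dact l (u, 1%g).
  move=> uU; apply/ffunP=> x; rewrite dact_left ffunE /corner -mulrA.
  by rewrite (evJ_idl ff lf) ?fst_mulJr.
apply/setP=> m; apply/imsetP/orbitP.
  case=> _ /(NatP ff f_kH)[u uU ->] ->; rewrite E //.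
  by exists (u, 1%g); rewrite ?imset_f.
case=> _ /imsetP[u uU ->] <-; exists (corner f u); rewrite ?E //.
by apply/NatP=> //; exists u.
Qed.

(** Right N_f-orbits are [Ksub f]-orbits, and [Dsub] normalises [Ksub f], so they all have the same
    size. *)
Lemma n_right_orbits_mul l : l \in Jdual_at f ->
  (n_right_orbits f (orbit dact_action Dsub l) * #|orbit dact_action (Ksub f)
    l|)%N
  = #|orbit dact_action Dsub l|.
Proof.
move=> lf.
rewrite -(card_orbits_mul dact_action l (K := Ksub_group f) (G := Dsub_group)
  Ksub_Dsub Dsub_norm) /n_right_orbits.
congr (#|pred_of_set _| * _)%N; apply: eq_in_imset => m /orbitP[d dD <-].
by rewrite right_orbitE // dact_Jdual_at.
Qed.

End Idempotent.
End Orbits.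

(** * Values of the supercharacter *)

Section Triangular.

Context {k : finFieldType} {hT : finGroupType} {T : triangularDatum k hT}.

Local Notation J := (tJ T).
Local Notation A := (triAlg T).
Local Notation uA := {unit triAlg T}.

(** The projection of G onto the abelian group H is a homomorphism, so conjugation fixes the
    H-component. *)
Lemma Gelt_conj h (y : J) r : r \in triG T ->
  exists y' : J, (Gelt h y ^ r)%g = Gelt h y'.
Proof.
move=> rG; have : (Gelt h y ^ r)%g \in triG T.
  by rewrite (groupJ (G := triG_group T)) // mem_triG.
case/imsetP=> -[h' y'] _ /= E; suff hh : h' = h by exists y'; rewrite E hh.
case/imsetP: rG E => -[t z] _ -> /= E.
have : (Gelt h y * Gelt t z = Gelt t z * Gelt h' y' :> uA)%g.
  by rewrite -E conjgE !mulgA mulgV mul1g.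
by rewrite !GeltM => /Gelt_inj[]; rewrite (@hT_mulC _ _ T) => /mulgI.
Qed.

Lemma Gelt_conjH s h (y : J) :
  (Gelt h y ^ (Gelt s 0)^-1)%g = Gelt h (lactJ s (ractJ y s^-1)%g) :> uA.
Proof.
rewrite conjgE invgK GeltH0V !GeltM !(lactJ0, ractJ0, mul0J, mulJ0) ?addr0
  ?add0r.
by rewrite (@hT_mulC _ _ T h) mulKVg.
Qed.

(** The order u s is chosen so that conjugation by (u s)^-1 first replaces x by s x s^-1 and only
    then involves u. *)
Lemma sum_triG (F : uA -> algC) :
  \sum_(r in triG T) F r =
  \sum_s \sum_(u in Usub (1 : A)) F (u * Gelt s 0)%g.
Proof.
rewrite big_imset /=; last by move=> [a v] [b w] _ _ /= /Gelt_inj[-> ->].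
rewrite -(pair_bigA _ (fun s v => F (Gelt s v))) /=; apply: eq_bigr => s _.
have inj_r : injective (fun v : J => ractJ v s).
  by move=> v w /(congr1 (fun v : J => ractJ v s^-1%g));
    rewrite -!ractM mulgV !ract1.
rewrite sum_Usub (reindex_inj inj_r) /=.
by apply: eq_big => v; rewrite ?Jsub1 // GeltMH0.
Qed.

Lemma inH_unit g : (inH g : A) \is a GRing.unit.
Proof.
by have := triUnit g (0 : T); rewrite inJ0 addr0.
Qed.

(** The fibres of g |-> g e are the cosets of H(e). *)
Lemma card_Hat (e : A) : (#|Hat e| * #|Hfix e|)%N = #|hT|.
Proof.
rewrite -[RHS]sum1_card.
rewrite (partition_big_imset (fun h => inH h * e) hT (fun=> 1%N)) /=.
rewrite -sum_nat_const; apply: eq_bigr => _ /imsetP[g _ ->].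
have E h : (h \in g *: Hfix e)%g = (inH h * e == inH g * e).
  rewrite mem_lcoset inE inHM -mulrA -(inj_eq (mulrI (inH_unit g))).
  by rewrite !mulrA -inHM mulgV inH1 mul1r.
by rewrite sum1_card -(card_lcoset _ g); apply: eq_card => h; rewrite E.
Qed.

Lemma associated_annihilates (f' c : A) h : c \in kH T -> f' \in kH T ->
  associated (inH h - 1) f' -> inH h * c = c -> f' * c = 0.
Proof.
move=> ck _ [u [v [uk vk uv vu E]]] hc.
by rewrite -[f']mul1r -vu -(mulrA v) -E -mulrA mulrBl mul1r hc subrr mulr0.
Qed.

End Triangular.

Section CornerSum.

Context {k : finFieldType} {hT : finGroupType} {T : triangularDatum k hT}.
Variables (eps : addChar k).

Local Notation J := (tJ T).
Local Notation A := (triAlg T).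

(** At 1 + w the exponent is m(y) + m(y w), whose second term is linear in w, so orthogonality on
    J_f tests whether m y = 0. *)
Lemma sum_Usub_right (f : A) m y : idem f -> m \in Jdual_at f -> y \in Jsub f ->
  \sum_(w in Usub f) eps (evJ m (inJ y * val w)) =
  #|Jsub f|%:R * (if [forall z, m (mulJ y z) == 0] then eps (m y) else 0).
Proof.
move=> fi mf yf; have mJ := Jdual_atW mf.
(* Testing on J_f suffices, since m(y z) = m(y f z f). *)
have -> : [forall z, m (mulJ y z) == 0] = [forall w in Jsub f, m (mulJ y w) ==
  0].
  apply/forallP/forall_inP => [H w _ //|H z].
  have fzf := inJK (fst_mulJ f f z).
  have -> : m (mulJ y z) = m (mulJ y (f * inJ z * f).2).
    rewrite -[LHS]/(evJ m (inJ (mulJ y z))) -[RHS]/(evJ m (inJ (mulJ y _))).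
    rewrite -!inJM fzf !mulrA (evJ_idr fi mf) ?fst_mulJl //.
    by case/JsubP: yf => _ ->.
  by apply: H; apply/JsubP; rewrite fzf !mulrA (eqP fi) -!mulrA (eqP fi).
rewrite sum_Usub; transitivity (eps (m y) * \sum_(w in Jsub f) eps (m (mulJ y
  w))).
  rewrite mulr_sumr; apply: eq_bigr => w _.
  by rewrite val_GeltE inH1 mulrDr mulr1 evJD // inJM addCharD.
rewrite addChar_subspace_sum ?Jsub0 //.
- by case: ifP => _; rewrite ?mulr1 ?mulr0 // mulrC.
- by move=> a u v; rewrite (mulJ_linr y a u v) (JdualZ mJ).
- by move=> a u v; apply: JsubZD.
Qed.

End CornerSum.

Section Value.

Context {k : finFieldType} {hT : finGroupType} {T : triangularDatum k hT}.
Variables (eps : addChar k) (al : superIndex T).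
Variables (l : {ffun T -> k}) (l_om : l \in si_omega al).

Local Notation J := (tJ T).
Local Notation A := (triAlg T).
Local Notation uA := {unit triAlg T}.
Local Notation e := (si_e al).

Let l_at : l \in Jdual_at e := proj1 (si_regular l_om).
Let lJ : l \in Jdual T := Jdual_atW l_at.

Lemma supcharE g : g \in triG T ->
  supchar eps l_om g =
  #|Glam al l|%:R^-1 *
    \sum_s \sum_(u in Usub (1 : A)) xi_fun eps al l (g ^ (u * Gelt s 0)^-1)%g.
Proof.
move=> gG; rewrite /supchar cfIndE; last first.
  by apply/subsetP=> _ /imset2P[h x _ _ ->]; apply: mem_triG.
congr (_ * _); rewrite -(sum_triG (fun r => xi_fun eps al l (g ^ r^-1)%g)).
rewrite (reindex_inj invg_inj) /=; apply: eq_big => r.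
  exact: (groupV (triG_group T)).
by move=> _; rewrite /xi cfunE.
Qed.

Lemma xi_fun_out h y : h \notin Hfix e -> xi_fun eps al l (Gelt h y) = 0.
Proof.
move=> hn; rewrite /xi_fun; case: imset2P => // -[h' y' h'e _ /Gelt_inj[E _]].
by rewrite E h'e in hn.
Qed.

Lemma xi_funE h y : h \in Hfix e ->
  xi_fun eps al l (Gelt h y) =
  if y \in Jright l then si_theta al h * eps (l y) else 0.
Proof.
move=> he; rewrite /xi_fun HpartE.
have -> : (Gelt h y \in Glam al l) = (y \in Jright l).
  apply/imset2P/idP => [[h' y' _ + /Gelt_inj[_ ->]]|yr] //.
  by exists h y.
by rewrite /evJ val_Gelt.
Qed.

Lemma card_Glam : #|Glam al l| = (#|Hfix e| * #|Jright l|)%N.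
Proof.
rewrite /Glam curry_imset2X card_in_imset ?cardsX //.
by move=> [a v] [b w] _ _ /= /Gelt_inj[-> ->].
Qed.

Section FixedPart.

Variables (h : hT) (he : h \in Hfix e).
Variables (f' : A) (f'k : f' \in kH T) (f'i : idem f').
Variable (f'a : associated (inH h - 1) f').

Variables (f : A) (fE : f = 1 - f').

Lemma compl_idem : idem f.
Proof.
by rewrite /idem fE mulrBl mul1r mulrBr mulr1 (eqP f'i) subrr subr0.
Qed.

Lemma compl_kH : f \in kH T.
Proof. by rewrite fE; apply: kHB => //; apply: kH1. Qed.

Lemma compl_annihl : f' * e = 0.
Proof.
apply: (associated_annihilates _ f'k f'a); first exact: si_kH.
by move: he; rewrite inE => /eqP.
Qed.

Lemma compl_mull : f * e = e.
Proof. by rewrite fE mulrBl mul1r compl_annihl subr0. Qed.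

Lemma compl_mulr : e * f = e.
Proof. by rewrite (kH_comm (si_kH al) compl_kH) compl_mull. Qed.

Lemma fixed_Jsub x : lactJ h x = x -> ractJ x h = x -> x \in Jsub f.
Proof.
case: f'a => u [v [uk vk uv vu E]] hx xh.
have E' : f' = v * (inH h - 1) by rewrite E mulrA vu mul1r.
have E'' : f' = (inH h - 1) * v.
  by rewrite E' kH_comm // kHB ?inH_kH ?kH1.
apply/JsubP; split.
  by rewrite fE mulrBl mul1r E' -mulrA mulrBl mul1r inHJ hx subrr mulr0 subr0.
by rewrite fE mulrBr mulr1 E'' mulrA mulrBr mulr1 inJH xh subrr mul0r subr0.
Qed.

(* Write u (h + x) u^-1 = h + y and m = l u. Then l y = 0 (as an element of *)
(* J^* ) iff m (h - 1 + x) = 0; multiplying on the right by f', which kills x *)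
(* and differs from h - 1 by a unit, splits this into m f' = 0 and m x = 0, *)
(* and under these conditions l(y) = m(x). *)
Lemma xi_fun_conj u x : u \in Usub (1 : A) ->
  lactJ h x = x -> ractJ x h = x ->
  let m := dact l (u, 1%g) in
  xi_fun eps al l (Gelt h x ^ u^-1)%g =
  if [forall z, evJ m (f' * inJ z) == 0] && [forall z, m (mulJ x z) == 0]
  then si_theta al h * eps (m x) else 0.
Proof.
move=> uU hx xh m; have mJ : m \in Jdual T by apply: dact_Jdual.
have mE c : c.1 = 0 -> evJ m c = evJ l (val u * c).
  exact: evJ_dact_left.
have lH c : c.1 = 0 -> evJ l (inH h * c) = evJ l c.
  move=> c0; rewrite -(inJK c0) inHJ.
  exact: (l_lact l_om).
have evJi w : evJ m (inJ w) = m w by [].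
have uG : u \in triG T by case/imsetP: uU => v _ ->; apply: mem_triG.
have [y yE] := Gelt_conj h x (groupVr (G := triG_group T) uG).
rewrite yE xi_funE //.
have yE' : val u * (inH h + inJ x) = (inH h + inJ y) * val u.
  rewrite -!val_GeltE -!FinRing.val_unitM -yE conjgE invgK.
  by rewrite !mulgA mulgKV.
(* From u (h + x) = (h + y) u, the left side is l((h - 1) u z) + l(y u z), and the first term
   vanishes because h lies in H(e). *)
have cond z : evJ m ((inH h - 1 + inJ x) * inJ z) = evJ l (inJ y * val u * inJ
  z).
  rewrite mE ?fst_mulJr // addrAC mulrA mulrBr mulr1 yE' mulrBl.
  rewrite evJB // !mulrDl evJD //.
  by rewrite -(mulrA (inH h)) lH ?fst_mulJr // [X in X - _]addrC addrK.
have condP : reflect (forall z, evJ m ((inH h - 1 + inJ x) * inJ z) = 0)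
    (y \in Jright l).
  rewrite inE; apply: (iffP forallP) => [yr z|H z].
    rewrite cond -mulrA -(inJK (fst_mulJr (val u) (erefl : (inJ z).1 = 0))).
    by rewrite inJM; apply/eqP/yr.
  have := H (val u^-1%g * inJ z).2; rewrite cond inJK ?fst_mulJr //.
  rewrite mulrA -(mulrA (inJ y)) -FinRing.val_unitM mulgV mulr1 inJM.
  by move/eqP.
have condE : (y \in Jright l) =
    [forall z, evJ m (f' * inJ z) == 0] && [forall z, m (mulJ x z) == 0].
  case: f'a => a [b [ak bk ab ba E]].
  have E'' : (inH h - 1) * b = f'.
    by rewrite kH_comm ?kHB ?inH_kH ?kH1 // E mulrA ba mul1r.
  apply/condP/andP => [H|[/forallP H1 /forallP H2] z]; last first.
    rewrite mulrDl evJD // inJM evJi (eqP (H2 _)) addr0 E (kH_comm ak f'k)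
      -mulrA.
    rewrite -(inJK (fst_mulJr a (erefl : (inJ z).1 = 0))).
    exact/eqP/H1.
  have H1 z : evJ m (f' * inJ z) = 0.
    (* Evaluated at b f' z, where (h - 1) b = f': the relation x f' = 0 removes x and leaves f' f' z
       = f' z. *)
    have := H (b * f' * inJ z).2; rewrite inJK ?fst_mulJr //.
    have x0 : inJ x * (b * f' * inJ z) = 0.
      by rewrite (kH_comm bk f'k) -E'' !mulrA mulrBr mulr1 inJH xh subrr !mul0r.
    by rewrite mulrDl evJD // x0 evJ0 // addr0 !mulrA E'' (eqP f'i).
  split; apply/forallP=> z; apply/eqP; first exact: H1.
  have := H z; rewrite mulrDl evJD // inJM E (kH_comm ak f'k) -mulrA.
  by rewrite -(inJK (fst_mulJr a (erefl : (inJ z).1 = 0))) H1 add0r.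
rewrite -condE; case: condP => // H; congr (_ * eps _).
have /imsetP[v _ uv] := uU.
have /imsetP[w _ uw] := groupVr (G := Usub_group 1) uU.
have wE : val u^-1%g = 1 + inJ w :> A by rewrite uw.
have vE : val u = 1 + inJ v :> A by rewrite uv.
have lH0 : evJ l (inH h) = 0 by exact: (evJ0 lJ).
have -> : l y = evJ l (val u * (inH h + inJ x) * val u^-1%g).
  rewrite yE' -mulrA -FinRing.val_unitM mulgV mulr1 evJD //.
  by rewrite lH0 add0r.
rewrite wE mulrDr mulr1 evJD //.
(* Here u^-1 = 1 + w, and the condition on m at w reads m((h + x) w) = m(w). *)
have -> : evJ l (val u * (inH h + inJ x) * inJ w) = evJ l (val u * inJ w).
  rewrite -!mulrA -!mE ?fst_mulJr //; apply/eqP; rewrite -subr_eq0 -evJB //.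
  by rewrite -[X in _ - X]mul1r -mulrBl addrAC H.
rewrite mulrDr evJD // -[evJ l (_ * inJ x)]mE // evJi addrAC.
have -> : evJ l (val u * inH h) = evJ l (val u).
  rewrite vE mulrDl mul1r !evJD // inJH; congr (_ + _); exact: (l_ract l_om).
(* l(u) + l(u w) = l(u u^-1) = l(1) = 0, so only m(x) survives. *)
rewrite -evJD // -[X in evJ l (X + _)]mulr1 -mulrDr -wE -FinRing.val_unitM.
by rewrite mulgV (evJ1 lJ) add0r.

Qed.

Lemma mul_compl : f * f' = 0.
Proof. by rewrite fE mulrBl mul1r (eqP f'i) subrr. Qed.

Lemma Jdual_at_fixed : l \in Jdual_at f.
Proof.
have ie := si_idem al; apply/(Jdual_atP _ compl_idem); split=> // c c0.
have [_ H] := Jdual_atP _ ie l_at.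
have fc (a b : A) : (a * c * b).1 = 0 by apply/fst_mulJl/fst_mulJr.
by rewrite -H // !mulrA compl_mulr -mulrA compl_mull H.
Qed.

(* If m = l (1 + v) and m f' = 0, then m = m f = l (1 + f v f), because l is *)
(* in J_f^* . *)
Lemma orbit_Ksub_fixed m :
  (m \in orbit dact_action (Ksub 1%R) l) && [forall z, evJ m (f' * inJ z) == 0]
    =
  (m \in orbit dact_action (Ksub f) l).
Proof.
have lf := Jdual_at_fixed.
apply/andP/orbitP => [[/orbitP[_ /imsetP[_ /imsetP[v _ ->] ->] <-] /forallP
  H]|].
  have fvf := inJK (fst_mulJ f f v); set v' := (f * inJ v * f).2 in fvf.
  exists (Gelt 1%g v', 1%g).
    apply/imset_f/imset_f/JsubP.
    by rewrite fvf !mulrA (eqP compl_idem) -!mulrA (eqP compl_idem).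
  set m' := dact_action _ _ in H *; have mJ : m' \in Jdual T by apply:
    dact_Jdual.
  apply/ffunP=> x; rewrite [LHS]dact_left.
  have -> : m' x = evJ m' (f * inJ x).
    rewrite [in RHS]fE mulrBl mul1r evJB // (eqP (H _)) subr0 //.
  have fx := inJK (fst_mulJr f (erefl : (inJ x).1 = 0)).
  rewrite -fx [RHS]dact_left fx !val_GeltE inH1 fvf !mulrDl !mul1r !evJD //.
  rewrite (evJ_idl compl_idem lf) //; congr (_ + _).
  by rewrite -!mulrA (evJ_idl compl_idem lf) ?fst_mulJl.
case=> _ /imsetP[_ /imsetP[v /JsubP[_ vf] ->] ->] <-; split.
  by apply/mem_orbit/imset_f/imset_f/Jsub1.
apply/forallP=> z; apply/eqP.
have fz := inJK (fst_mulJr f' (erefl : (inJ z).1 = 0)).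
rewrite -fz [LHS]dact_left fz val_GeltE inH1 mulrDl mul1r evJD //.
rewrite -vf -mulrA (mulrA f) mul_compl mul0r mulr0 (evJ0 lJ) addr0.
by rewrite -(evJ_idl compl_idem lf) ?fst_mulJr // mulrA mul_compl mul0r (evJ0
  lJ).
Qed.

Variables (x : J) (hx : lactJ h x = x) (xh : ractJ x h = x).

Let xs s := lactJ s (ractJ x s^-1%g).
Local Notation orbN := (orbit (dact_action (T := T)) (Ksub f) l).
Local Notation orbG := (orbit (dact_action (T := T)) (Dsub f) l).

Let lf := Jdual_at_fixed.

(** The factor |J_{l,right}| counts the u giving the same m = l u, and 1 / |J_f| normalises the sum
    over w that stands in for the condition m x_s = 0. *)
Lemma sum_xi_fun_conj s :
  \sum_(u in Usub (1 : A)) xi_fun eps al l (Gelt h x ^ (u * Gelt s 0)^-1)%g =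
  #|Jright l|%:R * si_theta al h / #|Jsub f|%:R *
    \sum_(m in orbN) \sum_(w in Usub f) eps (evJ m (inJ (xs s) * val w)).
Proof.
have hs : lactJ h (xs s) = xs s.
  by rewrite /xs -!lractC -lactM (@hT_mulC _ _ T h) lactM hx.
have sh : ractJ (xs s) h = xs s.
  by rewrite /xs lractC -ractM (@hT_mulC _ _ T s^-1%g) ractM xh.
have xf : xs s \in Jsub f by apply: fixed_Jsub.
pose F (m : {ffun T -> k}) :=
  if [forall z, evJ m (f' * inJ z) == 0] && [forall z, m (mulJ (xs s) z) == 0]
  then si_theta al h * eps (m (xs s)) else 0.
transitivity (\sum_(u in Usub (1 : A)) F (dact l (u, 1%g))).
  apply: eq_bigr => u uU; rewrite invMg conjgM Gelt_conjH.
  exact: xi_fun_conj.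
rewrite sum_Usub1 ?(Jdual_atW lf) // -!mulrA; congr (_ * _).
rewrite !mulr_sumr -[RHS](eq_bigl _ _ orbit_Ksub_fixed).
rewrite [RHS]big_mkcondr; apply: eq_bigr => m mO; rewrite /F.
case: (boolP [forall z, evJ m _ == 0]) => //= mf'.
have mf : m \in Jdual_at f.
  have := conj mO mf'; move/andP; rewrite orbit_Ksub_fixed.
  case/orbitP=> d dK <-; apply: (dact_Jdual_at compl_idem compl_kH) => //.
  exact: (subsetP (Ksub_Dsub f)).
rewrite (sum_Usub_right _ compl_idem mf xf) mulKf; first by case: ifP;
  rewrite ?mulr0.
by rewrite pnatr_eq0 -lt0n; apply/card_gt0P; exists 0; apply: Jsub0.
Qed.

(** The pair (u s, w s) sends l to a functional with value (l u)(x_s w^-1) at x; w is replaced by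
    its inverse, and the sum over u becomes one over the right orbit of l. *)
Lemma sum_Dsub_value :
  #|orbN|%:R * \sum_(d in Dsub f) eps (dact l d x) =
  #|Jsub f|%:R * \sum_s \sum_(m in orbN) \sum_(w in Usub f)
     eps (evJ m (inJ (xs s) * val w)).
Proof.
rewrite sum_Dsub !mulr_sumr; apply: eq_bigr => s _.
pose G m := \sum_(w in Usub f) eps (evJ m (inJ (xs s) * val w)).
rewrite -card_Ksub -(sum_over_orbit dact_action (Ksub_group f) G) sum_Ksub.
congr (_ * _); apply: eq_bigr => u _; rewrite /G (reindex_inj invg_inj) /=.
apply: eq_big => [w|w _]; first by rewrite (groupV (Usub_group f)).
rewrite -[dact l _ x]/(dact l (u * Gelt s 0, w^-1 * Gelt s 0)%g x).
rewrite dactE invMg invgK !FinRing.val_unitM GeltH0V.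
rewrite evJ_dact_left ?fst_mulJl // /xs -inHJ -inJH !mulrA.
by rewrite !val_GeltE inJ0 !addr0.
Qed.

Lemma supchar_value :
  supchar eps l_om (Gelt h x) =
  #|Hat e|%:R * si_theta al h / (n_right_orbits f orbG)%:R *
    \sum_(m in orbG) eps (m x).
Proof.
rewrite supcharE ?mem_triG //; under eq_bigr do rewrite sum_xi_fun_conj.
rewrite -mulr_sumr card_Glam natrM.
have E1 := sum_Dsub_value.
have E2 := sum_over_orbit dact_action (Dsub_group compl_kH)
  (fun m : {ffun T -> k} => eps (m x)) l.
rewrite /= card_Dsub -(card_Hat e) !natrM in E2.
have E3 : (n_right_orbits f orbG)%:R * #|orbN|%:R = #|orbG|%:R :> algC.
  by rewrite -natrM (n_right_orbits_mul compl_idem compl_kH lf).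
have O0 : #|orbN|%:R != 0 :> algC.
  by rewrite pnatr_eq0 -lt0n; apply/card_gt0P; exists l; apply: orbit_refl.
have Om0 : #|orbG|%:R != 0 :> algC.
  rewrite pnatr_eq0 -lt0n; apply/card_gt0P; exists l.
  exact: (orbit_refl dact_action (Dsub_group compl_kH)).
have J0 : #|Jsub f|%:R != 0 :> algC.
  by rewrite pnatr_eq0 -lt0n; apply/card_gt0P; exists 0; apply: Jsub0.
have R0 : #|Jright l|%:R != 0 :> algC.
  rewrite pnatr_eq0 -lt0n; apply/card_gt0P; exists 0; rewrite inE.
  by apply/forallP=> y; rewrite mul0J -[l 0]/(evJ l (0 : A)) (evJ0 (Jdual_atW
    lf)).
have H0 : #|Hfix e|%:R != 0 :> algC.
  by rewrite pnatr_eq0 -lt0n; apply/card_gt0P; exists h.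
have n0 : (n_right_orbits f orbG)%:R != 0 :> algC.
  by apply: contraNneq Om0 => n0; rewrite -E3 n0 mul0r.
move: E1 E2; rewrite -E3; set S1 := \sum_s _; set S2 := \sum_(d in _) _.
set S3 := \sum_(m in orbG) _ => E1 E2.
have -> : S1 = #|orbN|%:R * S2 / #|Jsub f|%:R by rewrite E1 mulrC mulKf.
have -> : S2 = #|Hat e|%:R * #|Hfix e|%:R * #|Jsub f|%:R ^+ 2 * S3 /
    ((n_right_orbits f orbG)%:R * #|orbN|%:R).
  by rewrite -E2 [RHS]mulrC mulKf // mulf_neq0.
by field; rewrite H0 R0 J0 n0 O0.
Qed.

End FixedPart.
End Value.

Theorem theorem6p4 (k : finFieldType) (hT : finGroupType)
    (T : triangularDatum k hT) (eps : addChar k) (alpha : superIndex T)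
    (lambda : {ffun T -> k}) (lambda_omega : lambda \in si_omega alpha)
    (h : hT) (x : T) (hx : lactJ h x = x) (xh : ractJ x h = x) :
  let e := si_e alpha in
  let chi := supchar eps lambda_omega in
  (h \notin Hfix e -> chi (Gelt h x) = 0) /\
  (h \in Hfix e ->
   forall (f' : triAlg T) (Omega : {set {ffun T -> k}}),
   f' \in kH T -> idem f' -> associated (inH h - 1) f' ->
   let f := 1 - f' in
   is_dual_orbit f Omega ->
   Omega :&: Jdual_at e = si_omega alpha ->
   chi (Gelt h x) =
     #|Hat e|%:R * si_theta alpha h / (n_right_orbits f Omega)%:R
       * \sum_(mu in Omega) eps (mu x)).
Proof.
move=> e chi; split=> [hn|he f' Omega f'k f'i f'a f [l lf ->] omE].
  rewrite /chi supcharE ?mem_triG // big1 ?mulr0 // => s _; apply: big1 => u uU.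
  have rG : (u * Gelt s 0)^-1%g \in triG T.
    rewrite (groupV (triG_group T)) (groupM (G := triG_group T)) ?mem_triG //.
    by case/imsetP: uU => v _ ->; apply: mem_triG.
  by have [y ->] := Gelt_conj h x rG; apply: xi_fun_out.
have fi := compl_idem f'i (erefl f); have fk := compl_kH f'k (erefl f).
have E := dual_orbitE fi fk lf.
(* Omega is given through some base point l; since omega lies in Omega, lambda can replace it. *)
have lO : lambda \in orbit dact_action (Dsub_group fk) l.
  by have := lambda_omega; rewrite -omE inE E => /andP[].
rewrite E -(orbit_eqP lO).
exact: (supchar_value eps lambda_omega
  he f'k f'i f'a (erefl f) hx xh).
Qed.
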